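(* Let $\mu:\mathbb{R}^d\to(0,\infty)$ be an integrable, continuously differentiable (unnormalized) density, let $M\in\mathbb{R}^{d\times d}$ be symmetric positive definite, and let $h>0$, $\delta>0$ and $m_{\max}\in\mathbb{N}$. Let $p_{\mathrm{micro}}(\cdot\mid\tilde\ell)$, $\tilde\ell\in 2^{\mathbb{N}}$, be any family of probability mass functions on the positive integers. Then the WALNUTS transition kernel $P$ on $\mathbb{R}^d$ (the law of the output $\tilde\theta$ of one WALNUTS transition started at $\theta$, as described in the context) is reversible with respect to the target distribution $\mu$; that is, for all Borel sets $A,A'\subseteq\mathbb{R}^d$, $$\int_A P(\theta,A')\,\mu(\theta)\,d\theta=\int_{A'}P(\theta,A)\,\mu(\theta)\,d\theta .$$
   Context: Notation: $\mathbb{N}=\{0,1,2,\dots\}$, $2^{\mathbb{N}}=\{2^n:n\in\mathbb{N}\}$, $a{:}b=\{a,a+1,\dots,b\}$ for integers $a\le b$. Hamiltonian: $H(\theta,\rho)=-\log\mu(\theta)+\frac12\rho^{\top}M^{-1}\rho$. Momentum flip: $\mathcal{F}(\theta,\rho)=(\theta,-\rho)$. Leapfrog map with step size $s>0$: $\Phi_s(\theta,\rho)=(\theta',\rho')$ with $\theta'=\theta+M^{-1}\big(s\rho+\frac{s^2}{2}\nabla\log\mu(\theta)\big)$ and $\rho'=\rho+\frac s2\big(\nabla\log\mu(\theta)+\nabla\log\mu(\theta')\big)$. $\Phi_s^j$ is its $j$-fold composition. Micro step selection: $\mathrm{micro}(\theta,\rho)=\min\{\ell\in2^{\mathbb{N}}:H_\ell^+-H_\ell^-\le\delta\}$,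 where $H_\ell^+$ and $H_\ell^-$ are the maximum and minimum of $H(\Phi_{h/\ell}^j(\theta,\rho))$ over $0\le j\le\ell$. It is assumed that this minimum exists for every $(\theta,\rho)\in\mathbb{R}^{2d}$. Macro steps. From $(\theta_0,\rho_0)$, states $(\theta_j,\rho_j)$, $j\in\mathbb{Z}$, are generated outward as needed. Forward ($j\ge 0$, from index $j$ to $j+1$): sample $\ell_j\sim p_{\mathrm{micro}}(\cdot\mid\mathrm{micro}(\theta_j,\rho_j))$ and set $(\theta_{j+1},\rho_{j+1})=\Phi_{h/\ell_j}^{\ell_j}(\theta_j,\rho_j)$. Backward ($j\le-1$, from index $j+1$ to $j$): sample $\ell_j\sim p_{\mathrm{micro}}(\cdot\mid\mathrm{micro}(\theta_{j+1},-\rho_{j+1}))$ and set $(\theta_j,\rho_j)=\mathcal{F}\circ\Phi_{h/\ell_j}^{\ell_j}\circ\mathcal{F}(\theta_{j+1},\rho_{j+1})$. The samples are independent given the states on which they are conditioned. Weights. Put $p_j^+=p_{\mathrm{micro}}(\ell_j\mid\mathrm{micro}(\theta_j,\rho_j))$ and $p_j^-=p_{\mathrm{micro}}(\ell_j\mid\mathrm{micro}(\theta_{j+1},-\rho_{j+1}))$. Then $w_0=e^{-H(\theta_0,\rho_0)}$; for $j>0$, $w_j=\frac{e^{-H(\theta_j,\rho_j)}}{e^{-H(\theta_{j-1},\rho_{j-1})}}\frac{p_{j-1}^-}{p_{j-1}^+}w_{j-1}$; for $j<0$, $w_j=\frac{e^{-H(\theta_j,\rho_j)}}{e^{-H(\theta_{j+1},\rho_{j+1})}}\frac{p_j^+}{p_j^-}w_{j+1}$.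 Orbits. An orbit over $a{:}b$ is the sequence $\mathcal{O}=((\theta_a,\rho_a),\dots,(\theta_b,\rho_b))$; its length is $b-a+1$. It satisfies the U-turn condition if $\min\big(\rho_a^{\top}M^{-1}(\theta_b-\theta_a),\ \rho_b^{\top}M^{-1}(\theta_b-\theta_a)\big)<0$. An orbit of length $2^k$ satisfies the sub-U-turn condition if at least one of its sub-orbits obtained by repeated halving (for some $0\le r\le k$, one of the $2^r$ consecutive blocks of length $2^{k-r}$, including the whole orbit) satisfies the U-turn condition. One WALNUTS transition from $\theta\in\mathbb{R}^d$: (1) Sample $\rho\sim\mathcal{N}(0,M)$; set $(\theta_0,\rho_0)=(\theta,\rho)$, $a_0=b_0=i_0=0$; sample i.i.d. Bernoulli$(1/2)$ variables $B_1,\dots,B_{m_{\max}}$. (2) For $k=0,1,\dots,m_{\max}-1$: let $\mathcal{O}_k$ be the current orbit over $a_k{:}b_k$, of length $2^k$. Let $a_k^{\mathrm{ext}}{:}b_k^{\mathrm{ext}}$ be $(b_k+1){:}(b_k+2^k)$ if $B_{k+1}=1$ and $(a_k-2^k){:}(a_k-1)$ if $B_{k+1}=0$; generate the extension orbit $\mathcal{O}_k^{\mathrm{ext}}$ over this range by macro steps. If $\mathcal{O}_k^{\mathrm{ext}}$ satisfies the sub-U-turn condition, stop with final index $i=i_k$. Otherwise, with probability $\min\big(1,\sum_{j\in a_k^{\mathrm{ext}}:b_k^{\mathrm{ext}}}w_j\big/\sum_{j\in a_k:b_k}w_j\big)$, draw $i_{k+1}$ from $a_k^{\mathrm{ext}}{:}b_k^{\mathrm{ext}}$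 with probabilities proportional to the $w_j$; otherwise set $i_{k+1}=i_k$. Let $\mathcal{O}_{k+1}$ be the orbit over $a_{k+1}{:}b_{k+1}=(a_k{:}b_k)\cup(a_k^{\mathrm{ext}}{:}b_k^{\mathrm{ext}})$. If $\mathcal{O}_{k+1}$ satisfies the U-turn condition or $k+1=m_{\max}$, stop with final index $i=i_{k+1}$. (3) Output $\tilde\theta=\theta_i$, where $i$ is the final index (if $m_{\max}=0$, $i=0$). *)

(* Defs.v *)
From HB Require Import structures.
From mathcomp Require Import all_boot all_order all_algebra.
From mathcomp Require Import all_classical all_reals all_analysis.

Set Implicit Arguments.
Unset Strict Implicit.
Unset Printing Implicit Defensive.

Import Order.TTheory GRing.Theory Num.Theory.
Import numFieldNormedType.Exports.

Local Open Scope classical_set_scope.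
Local Open Scope ring_scope.

Section borel_matrix.
Context {R : realType} {m n : nat}.

Let borel0 : <<s @open 'M[R]_(m, n) >> set0.
Proof. exact: sigma_algebra0. Qed.

Let borelC A :
  <<s @open 'M[R]_(m, n) >> A -> <<s @open 'M[R]_(m, n) >> (~` A).
Proof. exact: sigma_algebraC. Qed.

Let borel_bigcup (F : (set 'M[R]_(m, n))^nat) :
  (forall i, <<s @open 'M[R]_(m, n) >> (F i)) ->
  <<s @open 'M[R]_(m, n) >> (\bigcup_i (F i)).
Proof. exact: sigma_algebra_bigcup. Qed.

HB.instance Definition _ := @isMeasurable.Build
  (sigma_display (@open 'M[R]_(m, n))) 'M[R]_(m, n)
  <<s @open 'M[R]_(m, n) >> borel0 borelC borel_bigcup.

Lemma measurable_coord i j :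
  measurable_fun setT (fun A : 'M[R]_(m, n) => A i j).
Proof.
apply: (@measurability _ _ _ _ _ _ _ (measurable_realfun.RGenOpens.measurableE R)).
move=> _ [_ [a [b ->]] <-]; rewrite setTI; apply: sub_sigma_algebra.
apply: open_comp; last exact: interval_open.
by move=> x _; exact: coord_continuous.
Qed.

Lemma measurable_fun_mx d (T : measurableType d) (f : T -> 'M[R]_(m, n)) :
  (forall i j, measurable_fun setT (fun t => f t i j)) ->
  measurable_fun setT f.
Proof.
move=> mf; apply: (@measurability _ _ _ _ _ _ (@open 'M[R]_(m, n)) erefl).
move=> _ [U oU <-]; rewrite setTI.
pose good (p : 'M[rat]_(m, n) * rat) :=
  `[< 0 < p.2 /\ ball (map_mx ratr p.1 : 'M[R]_(m, n)) (ratr p.2) `<=` U >].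
pose F p : set T := if good p
  then [set t | forall i j, ball (ratr (p.1 i j) : R) (ratr p.2) (f t i j)]
  else set0.
have -> : f @^-1` U = \bigcup_p F p.
  apply/seteqP; split => [t Ut|t [p _]]; last first.
    rewrite /F; case: ifPn => // /asboolP[p0 pU] ft; apply: pU.
    by split => [|i j]; rewrite ?ltr0q// mxE; exact: ft.
  have /nbhs_ballP[e /= e0 eU] := open_nbhs_nbhs (conj oU Ut).
  have [r re] : exists r : rat, ratr r \in `]0, e / 2[%R.
    by apply: rat_in_itvoo; rewrite divr_gt0.
  move: re; rewrite in_itv/= ltr0q => /andP[r0 re].
  have /(_ _ _)/cid qP : forall i j, exists q : rat,
      ratr q \in `](f t i j - ratr r)%R, (f t i j + ratr r)%R[.
    move=> i j; apply: rat_in_itvoo.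
    by rewrite ltrBlDr -addrA ltrDl addr_gt0// ltr0q.
  pose q : 'M[rat]_(m, n) := \matrix_(i, j) sval (qP i j).
  have fq i j : ball (ratr (q i j) : R) (ratr r) (f t i j).
    rewrite mxE; case: (qP i j) => /= c; rewrite in_itv/= => /andP[c1 c2].
    by rewrite /ball/= ltr_distlC ltrBlDr c2 -ltrBlDr c1.
  exists (q, r) => //; rewrite /F ifT//=; apply/asboolP; split => //= y qy.
  apply: eU; split => // i j; rewrite (splitr e).
  apply: (@ball_triangle _ _ (ratr (q i j) : R)).
    by apply: ball_sym; apply: le_ball (fq i j); exact: ltW.
  by case: qy => _ /(_ i j); rewrite mxE; apply: le_ball; exact: ltW.
apply: countable_bigcupT_measurable => // p.
rewrite /F; case: ifP => // _.
rewrite (_ : mkset _ = \bigcap_(ij : 'I_m * 'I_n)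
    (fun t => f t ij.1 ij.2) @^-1` ball (ratr (p.1 ij.1 ij.2) : R) (ratr p.2)).
  apply: fin_bigcap_measurable => // -[i j] _ /=.
  by rewrite -[X in measurable X]setTI; apply: mf => //; apply: measurable_realfun.open_measurable; exact: ball_open.
by apply/seteqP; split => [t H [i j] _|t H i j]; [exact: H|exact: (H (i, j))].
Qed.

End borel_matrix.

Section lebesgue_vector.
Context {R : realType}.

Definition vcons n (p : R * 'cV[R]_n) : 'cV[R]_n.+1 := col_mx p.1%:M p.2.

Lemma measurable_vcons n : measurable_fun setT (@vcons n).
Proof.
apply: measurable_fun_mx => i j; rewrite /vcons; case: (@splitP 1 n i) => k ik.
  rewrite (_ : (fun _ => _) = fst); first exact: measurable_fst.
  apply/funext => t; rewrite (_ : i = lshift n k); last exact: val_inj.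
  by rewrite (@col_mxEu _ 1) !ord1 mxE eqxx mulr1n.
rewrite (_ : (fun _ => _) = (fun v : 'cV[R]_n => v k j) \o snd).
  by apply: measurableT_comp; [exact: measurable_coord|exact: measurable_snd].
apply/funext => t /=; rewrite (_ : i = rshift 1 k); last exact: val_inj.
by rewrite (@col_mxEd _ 1).
Qed.

Section push.
Context {n : nat} (m : {sigma_finite_measure set 'cV[R]_n -> \bar R}).

Definition lebesgue_vcons : set 'cV[R]_n.+1 -> \bar R :=
  pushforward (lebesgue_measure \x m)%E (@vcons n).

Let vcons0 : lebesgue_vcons set0 = 0%E.
Proof. by apply: measure0; exact: measurable_vcons. Qed.

Let vcons_ge0 A : (0 <= lebesgue_vcons A)%E.
Proof. by apply: measure_ge0; exact: measurable_vcons. Qed.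

Let vcons_sigma_additive : semi_sigma_additive lebesgue_vcons.
Proof. by apply: measure_semi_sigma_additive; exact: measurable_vcons. Qed.

HB.instance Definition _ := isMeasure.Build _ _ _ lebesgue_vcons
  vcons0 vcons_ge0 vcons_sigma_additive.

Let sigma_finite_vcons : sigma_finite setT lebesgue_vcons.
Proof.
have /sigma_finiteP[F [FT ndF Foo]] :=
  @sigma_finiteT _ _ _ (@lebesgue_measure R).
have /sigma_finiteP[G [GT ndG Goo]] := sigma_finiteT m.
pose g (v : 'cV[R]_n.+1) : R * 'cV[R]_n :=
  (v ord0 ord0, \col_i v (lift ord0 i) ord0).
have mg : measurable_fun setT g.
  apply: measurable_fun_pair => /=; first exact: measurable_coord.
  apply: measurable_fun_mx => i j; under eq_fun do rewrite mxE.
  exact: measurable_coord.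
have gK : cancel (@vcons n) g.
  move=> [x v]; rewrite /g /vcons /=; congr pair.
    rewrite (_ : ord0 = lshift n (ord0 : 'I_1)); last exact: val_inj.
    by rewrite (@col_mxEu _ 1) mxE eqxx mulr1n.
  apply/colP => i; rewrite mxE.
  rewrite (_ : lift ord0 i = rshift 1 i); last exact: val_inj.
  by rewrite (@col_mxEd _ 1).
exists (fun k => g @^-1` (F k `*` G k)) => [|k].
  rewrite -preimage_bigcup (_ : \bigcup_k _ = setT) ?preimage_setT//.
  apply/seteqP; split => // -[x v] _.
  have [i _ Fi] : (\bigcup_i F i) x by rewrite -FT.
  have [j _ Gj] : (\bigcup_i G i) v by rewrite -GT.
  exists (maxn i j) => //; split.
    by move: x Fi; exact/subsetPset/ndF/leq_maxl.
  by move: v Gj; exact/subsetPset/ndG/leq_maxr.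
have [mF Fk] := Foo k; have [mG Gk] := Goo k; split.
  by rewrite -[X in measurable X]setTI; apply: mg => //; exact: measurableX.
rewrite /lebesgue_vcons /pushforward -comp_preimage.
rewrite (_ : g \o @vcons n = id); last by apply/funext => x; exact: gK.
by rewrite preimage_id product_measure1E// lte_mul_pinfty// ge0_fin_numE.
Qed.

HB.instance Definition _ :=
  Measure_isSigmaFinite.Build _ _ _ lebesgue_vcons sigma_finite_vcons.
End push.

(* The n-fold product of the Lebesgue measure on R, on the Borel sets. *)
Fixpoint lebesgue_vec n : {sigma_finite_measure set 'cV[R]_n -> \bar R} :=
  match n with
  | 0 => [the {sigma_finite_measure set 'cV[R]_0 -> \bar R} of \d_(0 : 'cV[R]_0)]
  | n'.+1 => [the {sigma_finite_measure set 'cV[R]_n'.+1 -> \bar R}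
                of lebesgue_vcons (lebesgue_vec n')]
  end.

End lebesgue_vector.

Section calculus.
Context {R : realType} {d : nat}.

Definition gradient (f : 'cV[R]_d -> R) (x : 'cV[R]_d) : 'cV[R]_d :=
  \col_i 'D_(delta_mx i ord0) f x.

Definition continuously_differentiable (f : 'cV[R]_d -> R) :=
  (forall x, differentiable f x) /\ continuous (gradient f).

Definition symmetric_posdef (M : 'M[R]_d) :=
  M^T = M /\ forall x : 'cV[R]_d, x != 0 -> 0 < (x^T *m M *m x) ord0 ord0.

(* A mass function on the positive integers, extended by 0 at the index 0. *)
Definition is_pmf (p : nat -> R) :=
  [/\ p 0%N = 0, forall l, 0 <= p l & (\sum_(0 <= l <oo) (p l)%:E = 1)%E].

End calculus.

(* A random element X of T is represented by its expectation functional
   f |-> E[f(X)] on nonnegative f; its distribution is A |-> E[\1_A(X)].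
   [bind m k] draws x from m and then continues with the conditional law k x
   given x, so successive draws are independent given what they depend on. *)
Section laws.
Context {R : realType}.

Definition law (T : Type) := (T -> \bar R) -> \bar R.

Definition ret {T : Type} (x : T) : law T := fun f => f x.

Definition bind {S T : Type} (m : law S) (k : S -> law T) : law T :=
  fun f => m (fun x => k x f).

Definition pmf_law (p : nat -> R) : law nat :=
  fun f => (\sum_(0 <= l <oo) ((p l)%:E * f l))%E.

Definition bernoulli_law (q : R) : law bool :=
  fun f => (q%:E * f true + (1 - q)%:E * f false)%E.

Definition fair_coins (n : nat) : law (n.-tuple bool) :=
  fun f => (\sum_(B : n.-tuple bool) (((2^-1) ^+ n)%:E * f B))%E.

(* The law of m < n with probability proportional to w m. *)
Definition proportional_law (n : nat) (w : nat -> R) : law nat :=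
  fun f => (\sum_(m < n) ((w m / \sum_(m' < n) w m')%:E * f m))%E.

(* The centered normal distribution with covariance matrix M. *)
Definition gaussian_law {d : nat} (M : 'M[R]_d) : law 'cV[R]_d := fun f =>
  (\int[lebesgue_vec d]_rho
     (((Num.sqrt ((2 * pi) ^+ d * \det M))^-1 *
       expR (- ((rho^T *m invmx M *m rho) ord0 ord0 / 2)))%:E * f rho))%E.

End laws.

Arguments fair_coins {R} n.

Local Notation "x <~ m ;; k" := (bind m (fun x => k))
  (at level 61, m at next level, right associativity).

Section walnuts.
Context {R : realType} {d : nat}.
Variables (mu : 'cV[R]_d -> R) (M : 'M[R]_d) (h delta : R).
(* [p_micro l0 l] is the probability of l given l0; only the values of l0 that
   are powers of 2 matter. *)
Variable p_micro : nat -> nat -> R.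

Local Notation phase := ('cV[R]_d * 'cV[R]_d)%type.

Definition hamiltonian (z : phase) : R :=
  - ln (mu z.1) + (z.2^T *m invmx M *m z.2) ord0 ord0 / 2.

Definition flip (z : phase) : phase := (z.1, - z.2).

Definition grad_log (theta : 'cV[R]_d) : 'cV[R]_d :=
  gradient (fun x => ln (mu x)) theta.

Definition leapfrog (s : R) (z : phase) : phase :=
  let theta' :=
    z.1 + invmx M *m (s *: z.2 + (s ^+ 2 / 2) *: grad_log z.1) in
  (theta', z.2 + (s / 2) *: (grad_log z.1 + grad_log theta')).

Definition micro_steps (l j : nat) (z : phase) : phase :=
  iter j (leapfrog (h / l%:R)) z.

Definition energy_max (l : nat) (z : phase) : R :=
  \big[Num.max/hamiltonian z]_(j < l.+1) hamiltonian (micro_steps l j z).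

Definition energy_min (l : nat) (z : phase) : R :=
  \big[Num.min/hamiltonian z]_(j < l.+1) hamiltonian (micro_steps l j z).

Definition micro_ok (z : phase) (n : nat) : bool :=
  energy_max (2 ^ n) z - energy_min (2 ^ n) z <= delta.

(* The value 1 is a dummy, used only if no power of 2 is acceptable. *)
Definition micro (z : phase) : nat :=
  match pselect (exists n, micro_ok z n) with
  | left ex => (2 ^ ex_minn ex)%N
  | right _ => 1%N
  end.

(* Only finitely many entries are meaningful at any time: those at the indices
   generated so far; [tlev t j] belongs to the step between j and j + 1. *)
Record trajectory := Trajectory { tpos : int -> phase ; tlev : int -> nat }.

Definition step_forward (t : trajectory) (j : int) (l : nat) : trajectory :=
  Trajectory [eta tpos t with j + 1 |-> micro_steps l l (tpos t j)]
             [eta tlev t with j |-> l].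

Definition step_backward (t : trajectory) (j : int) (l : nat) : trajectory :=
  Trajectory
    [eta tpos t with j |-> flip (micro_steps l l (flip (tpos t (j + 1))))]
    [eta tlev t with j |-> l].

Fixpoint extend_forward (n : nat) (t : trajectory) (b : int) :
    @law R trajectory :=
  if n is n'.+1 then
    l <~ pmf_law (p_micro (micro (tpos t b))) ;;
    extend_forward n' (step_forward t b l) (b + 1)
  else ret t.

Fixpoint extend_backward (n : nat) (t : trajectory) (a : int) :
    @law R trajectory :=
  if n is n'.+1 then
    l <~ pmf_law (p_micro (micro (flip (tpos t a)))) ;;
    extend_backward n' (step_backward t (a - 1) l) (a - 1)
  else ret t.

Definition p_plus (t : trajectory) (j : int) : R :=
  p_micro (micro (tpos t j)) (tlev t j).

Definition p_minus (t : trajectory) (j : int) : R :=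
  p_micro (micro (flip (tpos t (j + 1)))) (tlev t j).

Definition boltzmann (t : trajectory) (j : int) : R :=
  expR (- hamiltonian (tpos t j)).

Fixpoint weight_forward (t : trajectory) (n : nat) : R :=
  if n is n'.+1 then
    boltzmann t n'.+1%:Z / boltzmann t n'%:Z *
    (p_minus t n'%:Z / p_plus t n'%:Z) * weight_forward t n'
  else boltzmann t 0.

Fixpoint weight_backward (t : trajectory) (n : nat) : R :=
  if n is n'.+1 then
    boltzmann t (- n'.+1%:Z) / boltzmann t (- n'%:Z) *
    (p_plus t (- n'.+1%:Z) / p_minus t (- n'.+1%:Z)) * weight_backward t n'
  else boltzmann t 0.

Definition weight (t : trajectory) (j : int) : R :=
  match j with
  | Posz n => weight_forward t n
  | Negz n => weight_backward t n.+1
  end.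

Definition u_turn (t : trajectory) (a b : int) : bool :=
  let dtheta := (tpos t b).1 - (tpos t a).1 in
  Num.min (((tpos t a).2^T *m invmx M *m dtheta) ord0 ord0)
          (((tpos t b).2^T *m invmx M *m dtheta) ord0 ord0) < 0.

(* The m-th of the 2 ^ r blocks of an orbit of length 2 ^ k starting at a. *)
Definition sub_u_turn (t : trajectory) (a : int) (k : nat) : bool :=
  [exists r : 'I_k.+1, exists m : 'I_(2 ^ r),
    u_turn t (a + (m * 2 ^ (k - r))%:Z) (a + (m.+1 * 2 ^ (k - r))%:Z - 1)].

Definition orbit_weight (t : trajectory) (a : int) (n : nat) : R :=
  \sum_(m < n) weight t (a + m%:Z).

(* The list [B] holds the coins not used yet, so it is empty exactly when
   k = m_max. If the extension has total weight 0, then the weights are not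
   normalizable, but the acceptance probability is 0. *)
Fixpoint doubling (k : nat) (B : seq bool) (t : trajectory) (a b i : int) :
    @law R 'cV[R]_d :=
  if B is B1 :: B' then
    let a_ext := if B1 then b + 1 else a - (2 ^ k)%:Z in
    let b_ext := if B1 then b + (2 ^ k)%:Z else a - 1 in
    t' <~ (if B1 then extend_forward (2 ^ k) t b
           else extend_backward (2 ^ k) t a) ;;
    if sub_u_turn t' a_ext k then ret (tpos t' i).1 else
    accepted <~ bernoulli_law (Num.min 1
      (orbit_weight t' a_ext (2 ^ k) / orbit_weight t' a (2 ^ k))) ;;
    i' <~ (if accepted then
             m <~ proportional_law (2 ^ k)
                    (fun m => weight t' (a_ext + m%:Z)) ;;
             ret (a_ext + m%:Z)
           else ret i) ;;
    let a' := if B1 then a else a_ext in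
    let b' := if B1 then b_ext else b in
    if u_turn t' a' b' then ret (tpos t' i').1
    else doubling k.+1 B' t' a' b' i'
  else ret (tpos t i).1.

Definition walnuts_transition (m_max : nat) (theta : 'cV[R]_d) :
    @law R 'cV[R]_d :=
  rho <~ gaussian_law M ;;
  B <~ fair_coins m_max ;;
  doubling 0 B (Trajectory (fun=> (theta, rho)) (fun=> 1%N)) 0 0 0.

Definition walnuts_kernel (m_max : nat) (theta : 'cV[R]_d)
    (A : set 'cV[R]_d) : \bar R :=
  walnuts_transition m_max theta (fun x => (\1_A x)%:E).

End walnuts.

(* Main.v *)
(* Describe an orbit by its leftmost state x and the list U of the levels of
   its steps, and give its j-th state the weight
     V_j = exp (- H(x_j)) * prod_(i < j) p_i^- * prod_(j <= i) p_i^+,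
   which is the density of x_j times the probability of generating the orbit
   from x_j. A macro step preserves volume and is inverted by flipping momenta,
   so the density of "start at x_j and generate this orbit" is V_j dx for every
   j, and the weights w_j of the algorithm are proportional to the V_j.

   After k doublings, let Q U x p q be the density of having started at position
   p of the orbit (x, U) and having the current index at position q. By
   induction on k, Q is symmetric in p and q and has row sums V_p, restricted to
   the orbits without sub-U-turn: when the halves L and R are joined, the pairs
   within one half are multiplied by 1 - min(1, V(R) / V(L)) or
   1 - min(1, V(L) / V(R)), and the pairs across the halves get the weight
   V_p V_q min(1 / V(L), 1 / V(R)). Whenever the transition stops, it does so
   with such a symmetric kernel, and this is reversibility. *)
Require Import Defs.
From HB Require Import structures.
From mathcomp Require Import all_boot all_order all_algebra.
From mathcomp Require Import all_classical all_reals all_analysis.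
From mathcomp Require Import measurable_realfun.
From mathcomp Require Import zify ring.
Import Order.TTheory GRing.Theory Num.Theory.
Import numFieldNormedType.Exports.

Set Implicit Arguments.
Unset Strict Implicit.
Unset Printing Implicit Defensive.

Local Open Scope classical_set_scope.
Local Open Scope ring_scope.

(** * Sums over levels and coins *)

(** A single coin does not give a symmetric kernel. A joined orbit is reached with coin [true] only
    from starts in its left half and with coin [false] only from starts in its right half, so the
    entries (p, q) and (q, p) across the halves come from opposite coins. Balance appears only after
    both values of a coin are added, and the leftmost state serves as the common coordinate in which
    they can be added; for the backward coin this costs a change of variables.

    The row sums belong to the induction because an accepted index is drawn independently of the old
    one: of the old index only the sum over its positions survives.

    Since [mu] is only continuously differentiable, the leapfrog map need not be differentiable, so
    volume preservation cannot go through a Jacobian. Leapfrog is split into shears instead, each of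
    which is a translation on every fibre.

    Level probabilities may vanish, and then the recursion for w_j divides by 0. The w_j are
    compared with the V_j only if V is nonzero at the start; all other orbits enter with probability
    0. *)

Section level_sum.
Context {R : realType}.
Implicit Types F G : seq nat -> \bar R.

(** A sum over all lists of length [n], written as iterated series so that it unfolds in step with
    the draws of [extend_forward]. *)
Fixpoint level_sum (n : nat) (F : seq nat -> \bar R) : \bar R :=
  if n is n'.+1 then (\sum_(0 <= l <oo) level_sum n' (fun E => F (l :: E)))%E
  else F [::].

Lemma level_sum_ge0 n F : (forall E, (0 <= F E)%E) -> (0 <= level_sum n F)%E.
Proof.
elim: n F => [|n IH] F F0 //=.
by apply: nneseries_ge0 => l _ _; apply: IH => E.
Qed.

Lemma eq_level_sum n F G :
  (forall E, size E = n -> F E = G E) -> level_sum n F = level_sum n G.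
Proof.
elim: n F G => [|n IH] F G FG /=; first exact: FG.
by apply: eq_eseriesr => l _; apply: IH => E En; apply: FG; rewrite /= En.
Qed.

Lemma level_sum_cat n m F :
  level_sum (n + m) F = level_sum n (fun E => level_sum m (fun E' => F (E ++ E'))).
Proof. by elim: n F => [|n IH] F //=; apply: eq_eseriesr => l _; rewrite IH. Qed.

Lemma level_sumZ n (c : R) F : (forall E, (0 <= F E)%E) ->
  level_sum n (fun E => c%:E * F E)%E = (c%:E * level_sum n F)%E.
Proof.
elim: n F => [|n IH] F F0 //=; rewrite -nneseriesZl => [|l _].
  by apply: eq_eseriesr => l _; rewrite IH.
exact: level_sum_ge0.
Qed.

Lemma level_sumD n F G : (forall E, (0 <= F E)%E) -> (forall E, (0 <= G E)%E) ->
  level_sum n (fun E => F E + G E)%E = (level_sum n F + level_sum n G)%E.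
Proof.
elim: n F G => [|n IH] F G F0 G0 //=.
rewrite -nneseriesD => [|l _ _|l _ _]; [|exact: level_sum_ge0..].
by apply: eq_eseriesr => l _; rewrite IH.
Qed.

Lemma level_sum_sum n (I : Type) (s : seq I) (F : I -> seq nat -> \bar R) :
  (forall i E, (0 <= F i E)%E) ->
  level_sum n (fun E => \sum_(i <- s) F i E)%E
  = (\sum_(i <- s) level_sum n (F i))%E.
Proof.
move=> F0; elim: s => [|i s IH].
  rewrite big_nil -[RHS](mul0e (level_sum n (fun=> 0%E))) -level_sumZ//.
  by apply: eq_level_sum => E _; rewrite big_nil mul0e.
rewrite big_cons -IH -level_sumD// => [|E]; last exact: sume_ge0.
by apply: eq_level_sum => E _; rewrite big_cons.
Qed.

Lemma level_sum_nneseries n (F : nat -> seq nat -> \bar R) :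
  (forall l E, (0 <= F l E)%E) ->
  level_sum n (fun E => \sum_(0 <= l <oo) F l E)%E
  = (\sum_(0 <= l <oo) level_sum n (F l))%E.
Proof.
elim: n F => [|n IH] F F0 //=.
under eq_eseriesr do rewrite IH//.
by rewrite nneseries_interchange// => i j; exact: level_sum_ge0.
Qed.

Lemma level_sum_exchange n m (F : seq nat -> seq nat -> \bar R) :
  (forall E E', (0 <= F E E')%E) ->
  level_sum n (fun E => level_sum m (F E))
  = level_sum m (fun E' => level_sum n (F ^~ E')).
Proof.
elim: n F => [|n IH] F F0 //=.
under eq_eseriesr do rewrite IH//.
by rewrite level_sum_nneseries// => l E; exact: level_sum_ge0.
Qed.

(** Serves the backward extension: the level drawn first there belongs to the step nearest to the
    old orbit, which stands last in left-to-right order. *)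
Lemma level_sumSr n F : (forall E, (0 <= F E)%E) ->
  level_sum n.+1 F
  = (\sum_(0 <= l <oo) level_sum n (fun E => F (rcons E l)))%E.
Proof.
move=> F0; rewrite -addn1 level_sum_cat level_sum_nneseries//.
apply: eq_eseriesr => l _.
by apply: eq_level_sum => E _; rewrite cats1.
Qed.

Lemma measurable_level_sum d (T : measurableType d) n
    (F : seq nat -> T -> \bar R) :
  (forall E x, (0 <= F E x)%E) -> (forall E, measurable_fun [set: T] (F E)) ->
  measurable_fun setT (fun x => level_sum n (F ^~ x)).
Proof.
elim: n F => [|n IH] F F0 mF /=; first exact: mF.
apply: (ge0_emeasurable_sum (P := xpredT)) => [l x _ _|l _].
  exact: level_sum_ge0.
exact: IH.
Qed.

Lemma integral_level_sum d (T : measurableType d)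
    (nu : {measure set T -> \bar R}) n (F : seq nat -> T -> \bar R) :
  (forall E x, (0 <= F E x)%E) -> (forall E, measurable_fun [set: T] (F E)) ->
  (\int[nu]_x level_sum n (F ^~ x))%E = level_sum n (fun E => \int[nu]_x F E x)%E.
Proof.
elim: n F => [|n IH] F F0 mF //=.
rewrite integral_nneseries//.
- by apply: eq_eseriesr => l _; rewrite IH.
- by move=> l; exact: measurable_level_sum.
- by move=> l x _; exact: level_sum_ge0.
Qed.

End level_sum.

(** * Sums over block positions and coins, and the acceptance identity *)

Section finite_sums.
Context {R : realType}.

Lemma sum_pow2S (V : nmodType) k (F : nat -> V) :
  \sum_(p < 2 ^ k.+1) F p
  = \sum_(p < 2 ^ k) F p + \sum_(p < 2 ^ k) F (2 ^ k + p)%N.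
Proof.
by rewrite -[LHS](big_mkord xpredT) expnS mul2n -addnn big_mkord big_split_ord.
Qed.

(** The Metropolis identity min(1, b / a) / b = min(1 / a, 1 / b), whose right side no longer tells
    the current block from the extension. In a block of weight 0 each entry is 0, which settles the
    degenerate quotients. *)
Lemma accept_balance (vp vq a b : R) : 0 <= vp -> 0 <= vq -> 0 <= a -> 0 <= b ->
  (a = 0 -> vp = 0) -> (b = 0 -> vq = 0) ->
  vp * (Num.min 1 (b / a) * (vq / b)) = vp * vq * Num.min a^-1 b^-1.
Proof.
move=> vp0 vq0 a0 b0 avp bvq.
have [/avp ->|a_neq0] := eqVneq a 0; first by rewrite !mul0r.
have [/bvq ->|b_neq0] := eqVneq b 0; first by rewrite !(mul0r, mulr0).
have -> : Num.min a^-1 b^-1 = b^-1 * Num.min 1 (b / a).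
  by rewrite minr_pMr ?invr_ge0// mulr1 mulrA mulVf// mul1r minC.
by ring.
Qed.

Lemma measurable_funV d (T : measurableType d) (f : T -> R) :
  (forall x, 0 <= f x) -> measurable_fun [set: T] f ->
  measurable_fun [set: T] (fun x => (f x)^-1).
Proof.
(* Inversion is discontinuous at 0, but on nonnegative reals it is the power with exponent -1, also
   at 0 where both are 0. *)
move=> f0 mf; under eq_fun do rewrite -powR_inv1//.
exact: (measurableT_comp (measurable_powR _)).
Qed.

(** Without the factor 2^-n, which is collected in [walnuts_kernelE]. The recursion puts the two
    values of the next coin side by side, as balance requires. *)
Fixpoint coin_sum n (F : seq bool -> \bar R) : \bar R :=
  if n is n'.+1 then (coin_sum n' (fun B => F (true :: B)) +
                      coin_sum n' (fun B => F (false :: B)))%E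
  else F [::].

Lemma eq_coin_sum n (F G : seq bool -> \bar R) :
  F =1 G -> coin_sum n F = coin_sum n G.
Proof. by move=> FG; congr coin_sum; apply/funext. Qed.

Lemma coin_sum_ge0 n (F : seq bool -> \bar R) :
  (forall B, (0 <= F B)%E) -> (0 <= coin_sum n F)%E.
Proof. by elim: n F => [|n IH] F F0 //=; rewrite adde_ge0// IH. Qed.

Lemma coin_sumD n (F G : seq bool -> \bar R) :
  coin_sum n (fun B => F B + G B)%E = (coin_sum n F + coin_sum n G)%E.
Proof. by elim: n F G => [|n IH] F G //=; rewrite !IH addeACA. Qed.

Lemma coin_sumZ n (c : R) (F : seq bool -> \bar R) :
  (forall B, (0 <= F B)%E) ->
  coin_sum n (fun B => c%:E * F B)%E = (c%:E * coin_sum n F)%E.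
Proof.
by elim: n F => [|n IH] F F0 //=; rewrite !IH// ge0_muleDr// coin_sum_ge0.
Qed.

Lemma sum_tuple_coin n (F : seq bool -> \bar R) :
  (\sum_(B : n.-tuple bool) F B)%E = coin_sum n F.
Proof.
elim: n F => [|n IH] F /=.
  rewrite (bigD1 [tuple])//= big1 ?adde0// => B.
  by case/eqP; exact: tuple0.
rewrite -!IH.
rewrite (reindex (fun p : bool * n.-tuple bool => [tuple of p.1 :: p.2]))/=; last first.
  exists (fun B => (thead B, [tuple of behead B])) => [[b B] _|B _] /=.
    by congr pair; apply/val_inj.
  by rewrite [RHS]tuple_eta; apply/val_inj.
by rewrite -(pair_bigA _ (fun b (B : n.-tuple bool) => F (b :: B)))/= big_bool.
Qed.

Lemma integral_coin_sum d (T : measurableType d) (nu : {measure set T -> \bar R})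
    n (F : seq bool -> T -> \bar R) :
  (forall B x, (0 <= F B x)%E) -> (forall B, measurable_fun [set: T] (F B)) ->
  (\int[nu]_x coin_sum n (F ^~ x))%E = coin_sum n (fun B => \int[nu]_x F B x)%E.
Proof.
move=> F0 mF; rewrite -sum_tuple_coin -ge0_integral_sum//.
by apply: eq_integral => x _; rewrite -sum_tuple_coin.
Qed.

Lemma measurable_coin_sum d (T : measurableType d) n (F : seq bool -> T -> \bar R) :
  (forall B, measurable_fun [set: T] (F B)) ->
  measurable_fun [set: T] (fun x => coin_sum n (F ^~ x)).
Proof.
move=> mF; under eq_fun do rewrite -sum_tuple_coin.
by apply: emeasurable_sum => B.
Qed.

End finite_sums.

Lemma pow2_predD k : ((2 ^ k).-1 + 2 ^ k = (2 ^ k.+1).-1)%N.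
Proof. by have := expn_gt0 2 k; rewrite expnS; lia. Qed.

Lemma pow2_predDr k : (2 ^ k + (2 ^ k).-1 = (2 ^ k.+1).-1)%N.
Proof. by rewrite addnC pow2_predD. Qed.

(** * Orbits and their weights *)

Section orbits.
Context {Z : Type} {R : realType}.
Variables (fwd bwd : nat -> Z -> Z) (pp pm : nat -> Z -> R) (e : Z -> R).
Variable ut : Z -> Z -> bool.

Definition opos (x : Z) (U : seq nat) (j : nat) : Z :=
  foldl (fun z l => fwd l z) x (take j U).

(** [U] is listed from left to right, so the last level is undone first; the result is the leftmost
    state of an orbit that ends at [x]. *)
Definition rewind (x : Z) (U : seq nat) : Z := foldr bwd x U.

Definition pr_fwd x U a b : R :=
  \prod_(a <= i < b) pp (nth 0%N U i) (opos x U i).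

Definition pr_bwd x U a b : R :=
  \prod_(a <= i < b) pm (nth 0%N U i) (opos x U i.+1).

Definition oweight x U j : R :=
  e (opos x U j) * pr_bwd x U 0 j * pr_fwd x U j (size U).

Definition bweight x U a k : R := \sum_(m < 2 ^ k) oweight x U (a + m)%N.

Definition subturn x U a k : bool :=
  [exists r : 'I_k.+1, exists m : 'I_(2 ^ r),
    ut (opos x U (a + m * 2 ^ (k - r))) (opos x U (a + m.+1 * 2 ^ (k - r)).-1)].

Lemma opos0 x U : opos x U 0 = x.
Proof. by rewrite /opos take0. Qed.

Lemma opos_catl x U W j : (j <= size U)%N -> opos x (U ++ W) j = opos x U j.
Proof. by move=> jU; rewrite /opos takel_cat. Qed.

Lemma opos_catr x W U j :
  opos x (W ++ U) (size W + j) = opos (opos x (W ++ U) (size W)) U j.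
Proof.
rewrite /opos [take (size W) _]take_size_cat// take_cat ltnNge leq_addr/= addKn.
by rewrite foldl_cat.
Qed.

Lemma oposS x U j : (j < size U)%N ->
  opos x U j.+1 = fwd (nth 0%N U j) (opos x U j).
Proof. by move=> jU; rewrite /opos (take_nth 0%N)// foldl_rcons. Qed.

Lemma opos_rewind x W U : (forall l z, fwd l (bwd l z) = z) ->
  opos (rewind x W) (W ++ U) (size W) = x.
Proof.
move=> K; rewrite /opos take_size_cat//.
by elim: W x => //= l W IH x; rewrite K IH.
Qed.

Lemma pr_fwd_catl x U W a b : (b <= size U)%N ->
  pr_fwd x (U ++ W) a b = pr_fwd x U a b.
Proof.
move=> bU; rewrite /pr_fwd; apply: eq_big_nat => i /andP[_ ib].
have iU := leq_trans ib bU.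
by rewrite nth_cat iU opos_catl// ltnW.
Qed.

Lemma pr_bwd_catl x U W a b : (b <= size U)%N ->
  pr_bwd x (U ++ W) a b = pr_bwd x U a b.
Proof.
move=> bU; rewrite /pr_bwd; apply: eq_big_nat => i /andP[_ ib].
have iU := leq_trans ib bU.
by rewrite nth_cat iU opos_catl.
Qed.

Lemma pr_fwd_catr x W U a b :
  pr_fwd x (W ++ U) (size W + a) (size W + b)
  = pr_fwd (opos x (W ++ U) (size W)) U a b.
Proof.
rewrite /pr_fwd addnC big_addn addKn; apply: eq_big_nat => i _.
by rewrite [(i + _)%N]addnC opos_catr nth_cat ltnNge leq_addr addKn.
Qed.

Lemma pr_bwd_catr x W U a b :
  pr_bwd x (W ++ U) (size W + a) (size W + b)
  = pr_bwd (opos x (W ++ U) (size W)) U a b.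
Proof.
rewrite /pr_bwd addnC big_addn addKn; apply: eq_big_nat => i _.
rewrite -addSn [(i.+1 + _)%N]addnC opos_catr [(i + _)%N]addnC.
by rewrite nth_cat ltnNge leq_addr addKn.
Qed.

(** From whichever position of [U] the orbit is grown, the steps of [W] are all drawn forward from
    the same states, so they contribute one factor independent of [j]. *)
Lemma oweight_catl x U W j : (j <= size U)%N ->
  oweight x (U ++ W) j
  = oweight x U j * pr_fwd x (U ++ W) (size U) (size U + size W).
Proof.
move=> jU; rewrite /oweight opos_catl// pr_bwd_catl// size_cat -!mulrA.
congr (_ * (_ * _)).
by rewrite -(pr_fwd_catl x W j (leqnn _)) /pr_fwd -big_cat_nat//= leq_addr.
Qed.

Lemma oweight_catr x W U j :
  oweight x (W ++ U) (size W + j)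
  = pr_bwd x (W ++ U) 0 (size W) * oweight (opos x (W ++ U) (size W)) U j.
Proof.
rewrite /oweight opos_catr size_cat pr_fwd_catr -pr_bwd_catr addn0.
rewrite {1}/pr_bwd (@big_cat_nat _ _ _ (size W))//= ?leq_addr//.
by rewrite -!/(pr_bwd _ _ _ _); ring.
Qed.

Lemma subturn_catl x U W a k : (a + 2 ^ k <= (size U).+1)%N ->
  subturn x (U ++ W) a k = subturn x U a k.
Proof.
move=> ak; rewrite /subturn; apply: eq_existsb => r; apply: eq_existsb => m.
have le : (m.+1 * 2 ^ (k - r) <= 2 ^ k)%N.
  have rk : (r <= k)%N by rewrite -ltnS.
  by rewrite -[in leqRHS](subnKC rk) expnD leq_mul2r ltn_ord orbT.
have lt := expn_gt0 2 (k - r).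
by rewrite !opos_catl//; nia.
Qed.

Lemma subturn_catr x W U a k :
  subturn x (W ++ U) (size W + a) k = subturn (opos x (W ++ U) (size W)) U a k.
Proof.
rewrite /subturn; apply: eq_existsb => r; apply: eq_existsb => m.
have lt : (0 < m.+1 * 2 ^ (k - r))%N by rewrite muln_gt0 expn_gt0.
rewrite -!addnA opos_catr; congr ut.
by rewrite -opos_catr; congr opos; lia.
Qed.

(** Splits the condition into the three tests that the algorithm makes at different times: the orbit
    before doubling, the extension, and the joined orbit as a whole. *)
Lemma subturnS x U a k :
  subturn x U a k.+1 = [|| ut (opos x U a) (opos x U (a + 2 ^ k.+1).-1),
    subturn x U a k | subturn x U (a + 2 ^ k) k].
Proof.
apply/idP/idP => [/existsP[[[|r] rk] /existsP[[m /= mr]]]|].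
- rewrite expn0 in mr; have -> : m = 0%N by lia.
  by rewrite mul0n addn0 mul1n subn0 => ->.
(* At depth [r.+1] the first 2^r blocks lie in the left half and the others, with number lowered by
   2^r, in the right half. *)
- rewrite subSS => um; have [mr'|mr'] := ltnP m (2 ^ r).
    apply/orP; right; apply/orP; left.
    apply/existsP; exists (Ordinal (rk : (r < k.+1)%N)).
    by apply/existsP; exists (Ordinal mr').
  apply/orP; right; apply/orP; right.
  apply/existsP; exists (Ordinal (rk : (r < k.+1)%N)).
  have mr2 : (m - 2 ^ r < 2 ^ r)%N by rewrite expnS in mr; lia.
  apply/existsP; exists (Ordinal mr2) => /=.
  have rk' : (r <= k)%N by rewrite -ltnS.
  have E : (2 ^ k = 2 ^ r * 2 ^ (k - r))%N by rewrite -expnD subnKC.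
  rewrite E -addnA -mulnDl subnKC//.
  rewrite -[(a + _ + _)%N]addnA -mulnDl; move: um.
  congr (is_true (ut _ (opos x U (a + _ * _).-1))).
  by lia.
- case/or3P => [um|/existsP[[r /= rk] /existsP[[m /= mr] um]]
    |/existsP[[r /= rk] /existsP[[m /= mr] um]]].
  + apply/existsP; exists ord0; apply/existsP.
    exists (Ordinal (ltn0Sn 0 : (0 < 2 ^ (ord0 : 'I_k.+2))%N)) => /=.
    by rewrite mul0n addn0 mul1n subn0.
  + apply/existsP; exists (Ordinal (rk : (r.+1 < k.+2)%N)).
    have mr' : (m < 2 ^ r.+1)%N by rewrite expnS; lia.
    by apply/existsP; exists (Ordinal mr'); rewrite /= subSS.
  + apply/existsP; exists (Ordinal (rk : (r.+1 < k.+2)%N)).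
    have mr' : (m + 2 ^ r < 2 ^ r.+1)%N by rewrite expnS; lia.
    apply/existsP; exists (Ordinal mr'); rewrite /= subSS.
    have rk' : (r <= k)%N by rewrite -ltnS.
    have E : (2 ^ k = 2 ^ r * 2 ^ (k - r))%N by rewrite -expnD subnKC.
    move: um; rewrite E; congr (is_true (ut (opos x U _) (opos x U _))); nia.
Qed.

(** Where the old orbit begins inside the joined one if the coin is [b]; the extension begins at
    [off (~~ b) k]. *)
Definition off (b : bool) (k : nat) : nat := if b then 0%N else (2 ^ k)%N.

(** The probability of generating the extension: its 2^k - 1 inner steps together with the step that
    joins the halves. *)
Definition pr_ext (b : bool) k x U : R :=
  if b then pr_fwd x U (2 ^ k).-1 (2 ^ k.+1).-1 else pr_bwd x U 0 (2 ^ k).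

Definition accept (b : bool) k x U : R :=
  Num.min 1 (bweight x U (off (~~ b) k) k / bweight x U (off b k) k).

(** One round of the loop after the extension is known: [c q'] is the expected output once the
    halves are joined and the current index sits at [q']. *)
Definition step_law (g : Z -> R) (b : bool) k x U q (c : nat -> \bar R) : \bar R :=
  (if subturn x U (off (~~ b) k) k then (g (opos x U (off b k + q)))%:E
   else (accept b k x U)%:E * (\sum_(m < 2 ^ k)
          (oweight x U (off (~~ b) k + m)%N / bweight x U (off (~~ b) k) k)%:E
          * c (off (~~ b) k + m)%N)
        + (1 - accept b k x U)%:E * c (off b k + q)%N)%E.

Definition whole_turn k x U : bool := ut (opos x U 0) (opos x U (2 ^ k).-1).

(* Expected value of g at the output of the transition, when the current orbit
   of length 2 ^ k has leftmost point x and levels U, the current index has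
   position q in it and the coins B are left. *)
Fixpoint outlaw (g : Z -> R) (B : seq bool) (k : nat) (x : Z) (U : seq nat)
    (q : nat) : \bar R :=
  if B is b :: B' then
    level_sum (2 ^ k) (fun E =>
      let x' := if b then x else rewind x E in
      let U' := if b then U ++ E else E ++ U in
      (pr_ext b k x' U')%:E * step_law g b k x' U' q (fun q' =>
        if whole_turn k.+1 x' U' then (g (opos x' U' q'))%:E
        else outlaw g B' k.+1 x' U' q'))%E
  else (g (opos x U q))%:E.

End orbits.

(** * Detailed balance of the orbit kernels *)

Section balance.
Context {d} {Z : measurableType d} {R : realType}.
Variables (fwd bwd : nat -> Z -> Z) (pp pm : nat -> Z -> R) (e : Z -> R).
Variable ut : Z -> Z -> bool.
Hypotheses (fwdK : forall l z, bwd l (fwd l z) = z)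
  (bwdK : forall l z, fwd l (bwd l z) = z)
  (mfwd : forall l, measurable_fun [set: Z] (fwd l))
  (mbwd : forall l, measurable_fun [set: Z] (bwd l))
  (pp_ge0 : forall l z, 0 <= pp l z) (pm_ge0 : forall l z, 0 <= pm l z)
  (mpp : forall l, measurable_fun [set: Z] (pp l))
  (mpm : forall l, measurable_fun [set: Z] (pm l))
  (e_ge0 : forall z, 0 <= e z) (me : measurable_fun [set: Z] e)
  (mut : forall f g : Z -> Z, measurable_fun [set: Z] f ->
    measurable_fun [set: Z] g -> measurable_fun [set: Z] (fun z => ut (f z) (g z))).
Implicit Types (f g : Z -> R) (x : Z) (U W E : seq nat) (k : nat).

Local Notation opos := (opos fwd).
Local Notation rewind := (rewind bwd).
Local Notation pr_fwd := (pr_fwd fwd pp).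
Local Notation pr_bwd := (pr_bwd fwd pm).
Local Notation oweight := (oweight fwd pp pm e).
Local Notation bweight := (bweight fwd pp pm e).
Local Notation subturn := (subturn fwd ut).
Local Notation pr_ext := (pr_ext fwd pp pm).
Local Notation accept := (accept fwd pp pm e).
Local Notation step_law := (step_law fwd pp pm e ut).
Local Notation whole_turn := (whole_turn fwd ut).
Local Notation outlaw := (outlaw fwd bwd pp pm e ut).

Lemma pr_fwd_ge0 x U a b : 0 <= pr_fwd x U a b.
Proof. exact: prodr_ge0. Qed.

Lemma pr_bwd_ge0 x U a b : 0 <= pr_bwd x U a b.
Proof. exact: prodr_ge0. Qed.

Lemma oweight_ge0 x U j : 0 <= oweight x U j.
Proof. by rewrite !mulr_ge0 ?pr_fwd_ge0 ?pr_bwd_ge0. Qed.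

Lemma bweight_ge0 x U a k : 0 <= bweight x U a k.
Proof. by apply: sumr_ge0 => m _; exact: oweight_ge0. Qed.

Lemma bweight_eq0 x U a k m : (m < 2 ^ k)%N -> bweight x U a k = 0 ->
  oweight x U (a + m) = 0.
Proof.
move=> mk /eqP; rewrite psumr_eq0 => [|i _]; last exact: oweight_ge0.
by move=> /allP/(_ (Ordinal mk)); rewrite mem_index_enum => /(_ isT)/eqP.
Qed.

Lemma pr_ext_ge0 b k x U : 0 <= pr_ext b k x U.
Proof. by case: b; [exact: pr_fwd_ge0|exact: pr_bwd_ge0]. Qed.

Lemma accept_ge0 b k x U : 0 <= accept b k x U.
Proof. by rewrite le_min ler01 divr_ge0 ?bweight_ge0. Qed.

Lemma accept_le1 b k x U : 0 <= 1 - accept b k x U.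
Proof. by rewrite subr_ge0 ge_min lexx. Qed.

Lemma step_law_ge0 g b k x U q c : (forall z, 0 <= g z) ->
  (forall q, (0 <= c q)%E) -> (0 <= step_law g b k x U q c)%E.
Proof.
move=> g0 c0; rewrite /step_law; case: ifP => _; first by rewrite lee_fin.
rewrite adde_ge0// mule_ge0// ?lee_fin ?accept_ge0 ?accept_le1//.
apply: sume_ge0 => m _; rewrite mule_ge0// lee_fin divr_ge0 ?oweight_ge0//.
exact: bweight_ge0.
Qed.

Lemma outlaw_ge0 g B k x U q : (forall z, 0 <= g z) ->
  (0 <= outlaw g B k x U q)%E.
Proof.
move=> g0; elim: B k x U q => [|b B IH] k x U q /=; first by rewrite lee_fin.
apply: level_sum_ge0 => E; rewrite mule_ge0 ?lee_fin ?pr_ext_ge0//.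
apply: step_law_ge0 => // q'; case: ifP => _; last exact: IH.
by rewrite lee_fin.
Qed.

Lemma measurable_opos U j : measurable_fun [set: Z] (fun x => opos x U j).
Proof.
rewrite /opos; elim: (take j U) => [|l W IH] /=; first exact: measurable_id.
have -> : (fun x => foldl (fun z l => fwd l z) (fwd l x) W) =
  (fun x => foldl (fun z l => fwd l z) x W) \o fwd l by [].
exact: measurableT_comp.
Qed.

Lemma measurable_rewind W : measurable_fun [set: Z] (rewind ^~ W).
Proof.
elim: W => [|l W IH] /=; first exact: measurable_id.
exact: (measurableT_comp (mbwd l)).
Qed.

Lemma measurable_pr_fwd U a b : measurable_fun [set: Z] (fun x => pr_fwd x U a b).
Proof.
apply: measurable_prod => i _.
exact: (measurableT_comp (mpp _) (measurable_opos _ _)).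
Qed.

Lemma measurable_pr_bwd U a b : measurable_fun [set: Z] (fun x => pr_bwd x U a b).
Proof.
apply: measurable_prod => i _.
exact: (measurableT_comp (mpm _) (measurable_opos _ _)).
Qed.

Lemma measurable_oweight U j : measurable_fun [set: Z] (fun x => oweight x U j).
Proof.
apply: measurable_funM; last exact: measurable_pr_fwd.
apply: measurable_funM; last exact: measurable_pr_bwd.
exact: (measurableT_comp me (measurable_opos _ _)).
Qed.

Lemma measurable_bweight U a k : measurable_fun [set: Z] (fun x => bweight x U a k).
Proof. by apply: measurable_sum => m; exact: measurable_oweight. Qed.

Lemma measurable_bweightV U a k :
  measurable_fun [set: Z] (fun x => (bweight x U a k)^-1).
Proof.
by apply: measurable_funV => [x|]; [exact: bweight_ge0|exact: measurable_bweight].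
Qed.

Lemma measurable_existsb (I : finType) (P : I -> Z -> bool) :
  (forall i, measurable_fun [set: Z] (P i)) ->
  measurable_fun [set: Z] (fun x => [exists i, P i x]).
Proof.
move=> mP; have -> : (fun x => [exists i, P i x]) = (fun x => has (P ^~ x) (enum I)).
  apply/funext => x; apply/existsP/hasP => [[i Pi]|[i _ Pi]]; last by exists i.
  by exists i; rewrite ?mem_enum.
elim: (enum I) => [|i s IH] /=; first exact: measurable_cst.
exact: measurable_or.
Qed.

Lemma measurable_subturn U a k : measurable_fun [set: Z] (fun x => subturn x U a k).
Proof.
apply: measurable_existsb => r; apply: measurable_existsb => m.
by apply: mut; exact: measurable_opos.
Qed.

Lemma measurable_whole_turn U k : measurable_fun [set: Z] (fun x => whole_turn k x U).
Proof. by apply: mut; exact: measurable_opos. Qed.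

Lemma measurable_pr_ext b k U : measurable_fun [set: Z] (fun x => pr_ext b k x U).
Proof. by case: b; [exact: measurable_pr_fwd|exact: measurable_pr_bwd]. Qed.

Lemma measurable_accept b k U : measurable_fun [set: Z] (fun x => accept b k x U).
Proof.
apply: measurable_minr; first exact: measurable_cst.
apply: measurable_funM; [exact: measurable_bweight|exact: measurable_bweightV].
Qed.

Lemma measurable_g_opos (g : Z -> R) U j : measurable_fun [set: Z] g ->
  measurable_fun [set: Z] (fun x => (g (opos x U j))%:E).
Proof.
by move=> mg; apply/measurable_EFinP; exact: (measurableT_comp mg (measurable_opos _ _)).
Qed.

Lemma measurable_step_law g b k U q (c : Z -> nat -> \bar R) :
  measurable_fun [set: Z] g -> (forall q, measurable_fun [set: Z] (c ^~ q)) ->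
  measurable_fun [set: Z] (fun x => step_law g b k x U q (c x)).
Proof.
move=> mg mc; apply: measurable_fun_ifT; first exact: measurable_subturn.
  exact: measurable_g_opos.
apply: emeasurable_funD; apply: emeasurable_funM => //.
- by apply/measurable_EFinP; exact: measurable_accept.
- apply: emeasurable_sum => m; apply: emeasurable_funM => //.
  apply/measurable_EFinP; apply: measurable_funM; first exact: measurable_oweight.
  exact: measurable_bweightV.
- apply/measurable_EFinP; apply: measurable_funB; first exact: measurable_cst.
  exact: measurable_accept.
Qed.

Lemma measurable_outlaw g B k U q : (forall z, 0 <= g z) ->
  measurable_fun [set: Z] g -> measurable_fun [set: Z] (fun x => outlaw g B k x U q).
Proof.
move=> g0 mg; elim: B k U q => [|b B IH] k U q /=; first exact: measurable_g_opos.
pose x' E x := if b then x else rewind x E; pose U' E := if b then U ++ E else E ++ U.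
apply: (@measurable_level_sum _ _ _ _ (fun E x => (pr_ext b k (x' E x) (U' E))%:E *
    step_law g b k (x' E x) (U' E) q (fun q' =>
      if whole_turn k.+1 (x' E x) (U' E) then (g (opos (x' E x) (U' E) q'))%:E
      else outlaw g B k.+1 (x' E x) (U' E) q'))%E).
  move=> E x; rewrite mule_ge0 ?lee_fin ?pr_ext_ge0//.
  apply: step_law_ge0 => // q'; case: ifP => _; last exact: outlaw_ge0.
  by rewrite lee_fin.
move=> E; set W := U' E.
pose h y := ((pr_ext b k y W)%:E * step_law g b k y W q
  (fun q' => if whole_turn k.+1 y W then (g (opos y W q'))%:E
             else outlaw g B k.+1 y W q'))%E.
have mh : measurable_fun [set: Z] h.
  apply: emeasurable_funM; first by apply/measurable_EFinP; exact: measurable_pr_ext.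
  apply: (@measurable_step_law _ _ _ _ _ (fun y q' => if whole_turn k.+1 y W
    then (g (opos y W q'))%:E else outlaw g B k.+1 y W q')) => // q'.
  apply: measurable_fun_ifT;
    [exact: measurable_whole_turn|exact: measurable_g_opos|exact: IH].
have mr : measurable_fun [set: Z] (x' E).
  by rewrite /x'; case: (b); [exact: measurable_id|exact: measurable_rewind].
exact: (measurableT_comp mh mr).
Qed.

Variable nu : {measure set Z -> \bar R}.
Hypothesis nu_fwd : forall l (F : Z -> \bar R), measurable_fun [set: Z] F ->
  (forall z, (0 <= F z)%E) -> (\int[nu]_z F (fwd l z) = \int[nu]_z F z)%E.

(** Each [bwd l] preserves [nu] because its inverse [fwd l] does. *)
Lemma integral_rewind E (F : Z -> \bar R) : measurable_fun [set: Z] F ->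
  (forall z, (0 <= F z)%E) -> (\int[nu]_z F (rewind z E) = \int[nu]_z F z)%E.
Proof.
elim: E F => [|l E IH] F mF F0 //=.
have mFb : measurable_fun [set: Z] (fun z => F (bwd l z)) by exact: measurableT_comp.
rewrite (IH (fun z => F (bwd l z)))// -(nu_fwd l (F := fun z => F (bwd l z)))//.
by apply: eq_integral => z _; rewrite fwdK.
Qed.

(** * Symmetric kernels on an orbit joined from two halves *)

Section union.
Variables (k : nat) (Q : seq nat -> Z -> nat -> nat -> R).
Hypotheses (Q_ge0 : forall U x p q, 0 <= Q U x p q)
  (mQ : forall U p q, measurable_fun [set: Z] (fun x => Q U x p q))
  (Q_sym : forall U x p q, Q U x p q = Q U x q p)
  (Q_sum : forall U x p, size U = (2 ^ k).-1 -> (p < 2 ^ k)%N ->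
     \sum_(q < 2 ^ k) Q U x p q = (~~ subturn x U 0 k)%:R * oweight x U p).

(** The level at index 2^k - 1 belongs to the step between the halves and is left out of both. *)
Definition block_levels (b : bool) U := if b then take (2 ^ k).-1 U else drop (2 ^ k) U.

(** The density when the start and the current index lie in the half given by [b] and the other half
    has just been generated, before it is tested or accepted. *)
Definition half_kernel b U x p q : R :=
  pr_ext b k x U * Q (block_levels b U) (opos x U (off b k)) p q.

Definition cross_kernel U x p q : R :=
  (~~ subturn x U 0 k && ~~ subturn x U (2 ^ k) k)%:R *
  (oweight x U p * oweight x U q *
   Num.min (bweight x U 0 k)^-1 (bweight x U (2 ^ k) k)^-1).

(* [stop_kernel] is for the pairs with which the transition stops because the
   extension has a sub-U-turn, [union_kernel] for those of the joined orbit. *)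
Definition union_kernel U x p q : R :=
  match (p < 2 ^ k)%N, (q < 2 ^ k)%N with
  | true, true => (~~ subturn x U (2 ^ k) k)%:R *
      ((1 - accept true k x U) * half_kernel true U x p q)
  | false, false => (~~ subturn x U 0 k)%:R *
      ((1 - accept false k x U) * half_kernel false U x (p - 2 ^ k) (q - 2 ^ k))
  | _, _ => cross_kernel U x p q
  end.

Definition stop_kernel U x p q : R :=
  match (p < 2 ^ k)%N, (q < 2 ^ k)%N with
  | true, true => (subturn x U (2 ^ k) k)%:R * half_kernel true U x p q
  | false, false => (subturn x U 0 k)%:R *
      half_kernel false U x (p - 2 ^ k) (q - 2 ^ k)
  | _, _ => 0
  end.

Lemma half_kernel_ge0 b U x p q : 0 <= half_kernel b U x p q.
Proof. by rewrite mulr_ge0// pr_ext_ge0. Qed.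

Lemma half_kernel_sym b U x p q : half_kernel b U x p q = half_kernel b U x q p.
Proof. by rewrite /half_kernel Q_sym. Qed.

(** [pr_ext] is exactly the common factor by which weights of a half differ from weights of the
    joined orbit, so the rows of [Q] become weights of the joined orbit. *)
Lemma half_kernel_sum b U x p : size U = (2 ^ k.+1).-1 -> (p < 2 ^ k)%N ->
  \sum_(q < 2 ^ k) half_kernel b U x p q
  = (~~ subturn x U (off b k) k)%:R * oweight x U (off b k + p).
Proof.
move=> sU pk; have k0 := expn_gt0 2 k; rewrite -mulr_sumr.
have sl : size (block_levels b U) = (2 ^ k).-1.
  case: b => /=; first by rewrite size_takel// sU -pow2_predD leq_addr.
  by rewrite size_drop sU -pow2_predDr addKn.
rewrite Q_sum// mulrCA; congr (_ * _).
  case: b sl => /= sl; rewrite ?opos0 /block_levels.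
    by rewrite -{2}(cat_take_drop (2 ^ k).-1 U) subturn_catl// sl add0n prednK.
  have sN : size (take (2 ^ k) U) = (2 ^ k)%N.
    by rewrite size_takel// sU -pow2_predDr leq_addr.
  have := @subturn_catr _ fwd ut x (take (2 ^ k) U) (drop (2 ^ k) U) 0 k.
  by rewrite sN addn0 cat_take_drop => ->.
case: b sl => /= sl; rewrite ?opos0 /block_levels.
  rewrite add0n -[in RHS](cat_take_drop (2 ^ k).-1 U) oweight_catl; last by rewrite sl; lia.
  by rewrite mulrC cat_take_drop -size_cat cat_take_drop sU sl.
have sN : size (take (2 ^ k) U) = (2 ^ k)%N.
  by rewrite size_takel// sU -pow2_predDr leq_addr.
have := @oweight_catr _ _ fwd pp pm e x (take (2 ^ k) U) (drop (2 ^ k) U) p.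
by rewrite sN cat_take_drop => ->.
Qed.

Lemma off_lt b p : (p < 2 ^ k)%N -> (off b k + p < 2 ^ k)%N = b.
Proof. by case: b => /= pk; rewrite ?add0n// ltnNge leq_addr. Qed.

Lemma union_kernel_diag b U x p q : (p < 2 ^ k)%N -> (q < 2 ^ k)%N ->
  union_kernel U x (off b k + p) (off b k + q)
  = (~~ subturn x U (off (~~ b) k) k)%:R *
    ((1 - accept b k x U) * half_kernel b U x p q).
Proof.
by move=> pk qk; rewrite /union_kernel !off_lt//; case: b => /=; rewrite ?addKn.
Qed.

Lemma stop_kernel_diag b U x p q : (p < 2 ^ k)%N -> (q < 2 ^ k)%N ->
  stop_kernel U x (off b k + p) (off b k + q)
  = (subturn x U (off (~~ b) k) k)%:R * half_kernel b U x p q.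
Proof.
by move=> pk qk; rewrite /stop_kernel !off_lt//; case: b => /=; rewrite ?addKn.
Qed.

Lemma stop_kernel_cross b U x p q : (p < 2 ^ k)%N -> (q < 2 ^ k)%N ->
  stop_kernel U x (off b k + p) (off (~~ b) k + q) = 0.
Proof. by move=> pk qk; rewrite /stop_kernel !off_lt//; case: b. Qed.

(* The minimum of the inverse block weights is symmetric in the two halves,
   which is where the acceptance probability is designed to give balance. *)
Lemma union_kernel_cross b U x p q : (p < 2 ^ k)%N -> (q < 2 ^ k)%N ->
  union_kernel U x (off b k + p) (off (~~ b) k + q)
  = (~~ subturn x U (off (~~ b) k) k)%:R *
    (((~~ subturn x U (off b k) k)%:R * oweight x U (off b k + p)) *
     (accept b k x U * (oweight x U (off (~~ b) k + q) / bweight x U (off (~~ b) k) k))).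
Proof.
move=> pk qk.
have -> : union_kernel U x (off b k + p) (off (~~ b) k + q)
    = cross_kernel U x (off b k + p) (off (~~ b) k + q).
  by rewrite /union_kernel !off_lt//; case: b.
rewrite -[in RHS]mulrA accept_balance ?oweight_ge0 ?bweight_ge0//; last 2 first.
- by move=> /bweight_eq0; exact.
- by move=> /bweight_eq0; exact.
rewrite /cross_kernel [RHS]mulrA -natrM mulnb.
by case: b => /=; [rewrite andbC|rewrite [Num.min _ _]minC].
Qed.

Lemma cross_kernel_ge0 U x p q : 0 <= cross_kernel U x p q.
Proof. by apply: mulr_ge0 => //; apply: mulr_ge0;
  rewrite ?le_min ?invr_ge0 ?bweight_ge0// mulr_ge0 ?oweight_ge0. Qed.

Lemma union_kernel_ge0 U x p q : 0 <= union_kernel U x p q.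
Proof.
rewrite /union_kernel; case: ifP => _; case: ifP => _; rewrite ?cross_kernel_ge0//;
  by apply: mulr_ge0 => //; apply: mulr_ge0; rewrite ?accept_le1 ?half_kernel_ge0.
Qed.

Lemma stop_kernel_ge0 U x p q : 0 <= stop_kernel U x p q.
Proof.
rewrite /stop_kernel; case: ifP => _; case: ifP => _//;
  by apply: mulr_ge0 => //; exact: half_kernel_ge0.
Qed.

Lemma union_kernel_sym U x p q : union_kernel U x p q = union_kernel U x q p.
Proof.
have cs : cross_kernel U x p q = cross_kernel U x q p.
  by rewrite /cross_kernel [oweight x U p * _]mulrC.
rewrite /union_kernel; case: ifP => _; case: ifP => _//;
  by rewrite half_kernel_sym.
Qed.

Lemma stop_kernel_sym U x p q : stop_kernel U x p q = stop_kernel U x q p.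
Proof.
rewrite /stop_kernel; case: ifP => _; case: ifP => _//;
  by rewrite half_kernel_sym.
Qed.

Lemma measurable_half_kernel b U p q :
  measurable_fun [set: Z] (fun x => half_kernel b U x p q).
Proof.
apply: measurable_funM; first exact: measurable_pr_ext.
exact: (measurableT_comp (mQ _ _ _) (measurable_opos _ _)).
Qed.

Lemma measurable_subturnC U a b :
  measurable_fun [set: Z] (fun x => (~~ subturn x U a b)%:R : R).
Proof.
have -> : (fun x => (~~ subturn x U a b)%:R : R)
  = (fun x => if subturn x U a b then 0 else 1).
  by apply/funext => x; case: ifP.
apply: measurable_fun_ifT; [exact: measurable_subturn|exact: measurable_cst..].
Qed.

Lemma measurable_subturnN U a b :
  measurable_fun [set: Z] (fun x => (subturn x U a b)%:R : R).
Proof.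
have -> : (fun x => (subturn x U a b)%:R : R)
  = (fun x => if subturn x U a b then 1 else 0).
  by apply/funext => x; case: ifP.
apply: measurable_fun_ifT; [exact: measurable_subturn|exact: measurable_cst..].
Qed.

Lemma measurable_cross_kernel U p q :
  measurable_fun [set: Z] (fun x => cross_kernel U x p q).
Proof.
apply: measurable_funM.
  under eq_fun do rewrite -mulnb natrM.
  by apply: measurable_funM; exact: measurable_subturnC.
apply: measurable_funM; first by apply: measurable_funM; exact: measurable_oweight.
by apply: measurable_minr; exact: measurable_bweightV.
Qed.

Lemma measurable_union_kernel U p q :
  measurable_fun [set: Z] (fun x => union_kernel U x p q).
Proof.
have mB b : measurable_fun [set: Z] (fun x => 1 - accept b k x U).
  by apply: measurable_funB; [exact: measurable_cst|exact: measurable_accept].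
rewrite /union_kernel; case: (p < 2 ^ k)%N; case: (q < 2 ^ k)%N;
  try exact: measurable_cross_kernel;
  by apply: measurable_funM; [exact: measurable_subturnC|apply: measurable_funM;
    [exact: mB|exact: measurable_half_kernel]].
Qed.

Lemma measurable_stop_kernel U p q :
  measurable_fun [set: Z] (fun x => stop_kernel U x p q).
Proof.
rewrite /stop_kernel; case: (p < 2 ^ k)%N; case: (q < 2 ^ k)%N;
  try exact: measurable_cst;
  by apply: measurable_funM; [exact: measurable_subturnN|exact: measurable_half_kernel].
Qed.

(** In each row the share [1 - accept] stays in the half of [p] and the share [accept] is spread
    over the other half, so the total is again the weight of [p]. One indicator comes from [Q_sum],
    the other from the test of the extension. *)
Lemma union_kernel_sum U x p : size U = (2 ^ k.+1).-1 -> (p < 2 ^ k.+1)%N ->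
  \sum_(q < 2 ^ k.+1) union_kernel U x p q
  = (~~ subturn x U 0 k && ~~ subturn x U (2 ^ k) k)%:R * oweight x U p.
Proof.
move=> sU pk1.
have [b [p' [p'k ->]]] : exists b p', (p' < 2 ^ k)%N /\ p = (off b k + p')%N.
  have [pk|pk] := ltnP p (2 ^ k); first by exists true, p.
  by exists false, (p - 2 ^ k)%N; split; rewrite /= ?subnKC//; rewrite expnS in pk1; lia.
have -> : \sum_(q < 2 ^ k.+1) union_kernel U x (off b k + p') q
    = \sum_(q < 2 ^ k) union_kernel U x (off b k + p') (off b k + q)
    + \sum_(q < 2 ^ k) union_kernel U x (off b k + p') (off (~~ b) k + q).
  by rewrite sum_pow2S; case: (b) => //=; rewrite addrC.
under eq_bigr do rewrite union_kernel_diag//.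
rewrite -2!mulr_sumr half_kernel_sum//.
under eq_bigr do rewrite union_kernel_cross//.
have bE : \sum_(q < 2 ^ k) (oweight x U (off (~~ b) k + q) / bweight x U (off (~~ b) k) k)
    = bweight x U (off (~~ b) k) k / bweight x U (off (~~ b) k) k.
  by rewrite -mulr_suml.
rewrite -3!mulr_sumr bE.
have -> : (~~ subturn x U 0 k && ~~ subturn x U (2 ^ k) k)
    = (~~ subturn x U (off (~~ b) k) k && ~~ subturn x U (off b k) k).
  by case: (b) => //=; rewrite andbC.
rewrite -mulnb natrM -[RHS]mulrA -mulrDr; congr (_ * _).
(* For an extension of weight 0 the acceptance probability is 0, and the whole row stays in its own
   half. *)
have [W0|W0] := eqVneq (bweight x U (off (~~ b) k) k) 0.
  by rewrite /accept W0 !mul0r min_r// !mulr0 addr0 subr0 mul1r.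
by rewrite divff// mulr1 [X in _ + X]mulrC -mulrDl subrK mul1r.
Qed.

(** The accepted part of [step_law] does not depend on the old index [q], so the row of
    [half_kernel] can be summed in it; this yields the weight of [p], and what remains is a row
    across the halves. Only the rejected and the stopped parts keep track of [q]. *)
Lemma step_balance b f g U x p (c : nat -> \bar R) :
  (forall z, 0 <= f z) -> (forall q, (0 <= c q)%E) ->
  size U = (2 ^ k.+1).-1 -> (p < 2 ^ k)%N ->
  (\sum_(q < 2 ^ k) (half_kernel b U x p q * f (opos x U (off b k + p)))%:E *
     step_law g b k x U q c
   = \sum_(q < 2 ^ k)
      ((stop_kernel U x (off b k + p) (off b k + q) * f (opos x U (off b k + p)) *
        g (opos x U (off b k + q)))%:E +
       ((union_kernel U x (off b k + p) (off b k + q) * f (opos x U (off b k + p)))%:E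
         * c (off b k + q)%N +
        (union_kernel U x (off b k + p) (off (~~ b) k + q) * f (opos x U (off b k + p)))%:E
         * c (off (~~ b) k + q)%N)))%E.
Proof.
move=> f0 c0 sU pk; set fp := f _; have fp0 : 0 <= fp by exact: f0.
have [su|su] := boolP (subturn x U (off (~~ b) k) k).
  apply: eq_bigr => q _; rewrite /step_law su.
  rewrite stop_kernel_diag// union_kernel_diag// union_kernel_cross// su.
  by rewrite !mul0r !mul0e !adde0 mul1r -EFinM.
under [RHS]eq_bigr => q _.
  rewrite stop_kernel_diag// union_kernel_diag// union_kernel_cross// (negbTE su).
  rewrite !mul0r add0e !mul1r; over.
rewrite /= /step_law (negbTE su).
set S := (\sum_(m < _) _)%E.
have S0 : (0 <= S)%E.
  apply: sume_ge0 => m _; rewrite mule_ge0// lee_fin divr_ge0 ?oweight_ge0//.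
  exact: bweight_ge0.
transitivity (\sum_(q < 2 ^ k) ((half_kernel b U x p q * (fp * accept b k x U))%:E * S +
   ((1 - accept b k x U) * half_kernel b U x p q * fp)%:E * c (off b k + q)%N))%E.
  apply: eq_bigr => q _; rewrite ge0_muleDr.
  - by rewrite !muleA -!EFinM; congr (_%:E * _ + _%:E * _)%E; ring.
  - by rewrite mule_ge0// lee_fin accept_ge0.
  - by rewrite mule_ge0// lee_fin accept_le1.
rewrite !big_split/= addeC; congr (_ + _)%E.
rewrite -ge0_sume_distrl => [|q _]; last first.
  by rewrite lee_fin mulr_ge0 ?half_kernel_ge0// mulr_ge0 ?accept_ge0.
rewrite sumEFin -mulr_suml half_kernel_sum//.
rewrite ge0_sume_distrr => [|m _]; last first.
  rewrite mule_ge0// lee_fin divr_ge0 ?oweight_ge0//.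
  exact: bweight_ge0.
apply: eq_bigr => m _; rewrite muleA -EFinM; congr (_%:E * _)%E; ring.
Qed.

End union.

(** * Joint law of the start and the current state under one doubling *)

Definition outlaw_next (g : Z -> R) B k x U q : \bar R :=
  if whole_turn k x U then (g (opos x U q))%:E else outlaw g B k x U q.

Lemma outlaw_next_ge0 g B k x U q : (forall z, 0 <= g z) ->
  (0 <= outlaw_next g B k x U q)%E.
Proof.
by move=> g0; rewrite /outlaw_next; case: ifP => _; rewrite ?lee_fin ?outlaw_ge0.
Qed.

Lemma measurable_outlaw_next g B k U q : (forall z, 0 <= g z) ->
  measurable_fun [set: Z] g ->
  measurable_fun [set: Z] (fun x => outlaw_next g B k x U q).
Proof.
move=> g0 mg; apply: measurable_fun_ifT; first exact: measurable_whole_turn.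
  exact: measurable_g_opos.
exact: measurable_outlaw.
Qed.

(* Q U x p q is meant to be the density of having started at position p of the
   orbit (x, U) and having the current index at position q. *)
Definition joint k (Q : seq nat -> Z -> nat -> nat -> R) (f g : Z -> R) B : \bar R :=
  level_sum (2 ^ k).-1 (fun U => \int[nu]_x (\sum_(p < 2 ^ k) \sum_(q < 2 ^ k)
    (Q U x p q * f (opos x U p))%:E * outlaw g B k x U q))%E.

(** The integrand of [joint] once coin [b] is spent, expressed through the leftmost state and the
    levels of the joined orbit. *)
Definition half_joint k Q b (f g : Z -> R) B U x : \bar R :=
  (\sum_(p < 2 ^ k) \sum_(q < 2 ^ k)
    (half_kernel k Q b U x p q * f (opos x U (off b k + p)))%:E *
    step_law g b k x U q (outlaw_next g B k.+1 x U))%E.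

Section joint.
Variables (k : nat) (Q : seq nat -> Z -> nat -> nat -> R) (f g : Z -> R).
Hypotheses (Q_ge0 : forall U x p q, 0 <= Q U x p q)
  (mQ : forall U p q, measurable_fun [set: Z] (fun x => Q U x p q))
  (f_ge0 : forall z, 0 <= f z) (mf : measurable_fun [set: Z] f)
  (g_ge0 : forall z, 0 <= g z) (mg : measurable_fun [set: Z] g).

Lemma half_joint_ge0 b B U x : (0 <= half_joint k Q b f g B U x)%E.
Proof.
apply: sume_ge0 => p _; apply: sume_ge0 => q _; rewrite mule_ge0//.
  by rewrite lee_fin mulr_ge0// half_kernel_ge0.
by apply: step_law_ge0 => // q'; exact: outlaw_next_ge0.
Qed.

Lemma measurable_half_joint b B U :
  measurable_fun [set: Z] (half_joint k Q b f g B U).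
Proof.
apply: emeasurable_sum => p; apply: emeasurable_sum => q; apply: emeasurable_funM.
  apply/measurable_EFinP; apply: measurable_funM; first exact: measurable_half_kernel.
  exact: (measurableT_comp mf (measurable_opos _ _)).
apply: (@measurable_step_law _ _ _ _ _ (fun x => outlaw_next g B k.+1 x U)) => // q'.
exact: measurable_outlaw_next.
Qed.

Lemma half_jointE b B U E x : size U = (2 ^ k).-1 -> size E = (2 ^ k)%N ->
  let x' := if b then x else rewind x E in
  let U' := if b then U ++ E else E ++ U in
  (\sum_(p < 2 ^ k) \sum_(q < 2 ^ k) (Q U x p q * f (opos x U p))%:E *
    ((pr_ext b k x' U')%:E * step_law g b k x' U' q (outlaw_next g B k.+1 x' U'))
  = half_joint k Q b f g B U' x')%E.
Proof.
move=> sU sE x' U'; have k0 := expn_gt0 2 k.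
have ox : opos x' U' (off b k) = x.
  rewrite /x' /U'; case: (b) => /=; first by rewrite opos0.
  by rewrite -sE opos_rewind.
have bU : block_levels k b U' = U.
  rewrite /U' /block_levels; case: (b); first by rewrite -sU take_size_cat.
  by rewrite drop_size_cat.
have op p : (p < 2 ^ k)%N -> opos x' U' (off b k + p) = opos x U p.
  move=> pk; move: ox; rewrite /x' /U'; case: (b) => /=.
    by rewrite opos0 add0n opos_catl// sU; lia.
  by rewrite -sE => ox; rewrite opos_catr ox.
apply: eq_bigr => p _; apply: eq_bigr => q _.
rewrite op// /half_kernel ox bU muleA -EFinM; congr (_%:E * _)%E.
ring.
Qed.

(** With a backward coin the joined orbit begins at [rewind x E]; volume preservation makes that
    state the variable of integration. Thus both coins lead to integrals over the same joined
    orbits. *)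
Lemma joint_cons b B :
  joint k Q f g (b :: B)
  = level_sum (2 ^ k.+1).-1 (fun U => \int[nu]_x half_joint k Q b f g B U x)%E.
Proof.
pose x' E x := if b then x else rewind x E.
pose U' U E := if b then U ++ E else E ++ U.
pose F U E x := (\sum_(p < 2 ^ k) \sum_(q < 2 ^ k) (Q U x p q * f (opos x U p))%:E *
    ((pr_ext b k (x' E x) (U' U E))%:E *
      step_law g b k (x' E x) (U' U E) q (outlaw_next g B k.+1 (x' E x) (U' U E))))%E.
have t0 U x p q E : (0 <= (Q U x p q * f (opos x U p))%:E *
    ((pr_ext b k (x' E x) (U' U E))%:E *
      step_law g b k (x' E x) (U' U E) q (outlaw_next g B k.+1 (x' E x) (U' U E))))%E.
  rewrite mule_ge0 ?lee_fin ?mulr_ge0// mule_ge0 ?lee_fin ?pr_ext_ge0//.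
  by apply: step_law_ge0 => // q'; exact: outlaw_next_ge0.
have mx' E : measurable_fun [set: Z] (x' E).
  by rewrite /x'; case: (b); [exact: measurable_id|exact: measurable_rewind].
transitivity (level_sum (2 ^ k).-1 (fun U => level_sum (2 ^ k) (fun E =>
    \int[nu]_x half_joint k Q b f g B (U' U E) x)))%E.
  apply: eq_level_sum => U sU.
  transitivity (\int[nu]_x level_sum (2 ^ k) (fun E => F U E x))%E.
    apply: eq_integral => x _; rewrite level_sum_sum => [|p E]; last first.
      by apply: sume_ge0 => q _; exact: t0.
    apply: eq_bigr => p _; rewrite level_sum_sum => [|q E]; last exact: t0.
    apply: eq_bigr => q _; rewrite -level_sumZ// => E.
    rewrite mule_ge0 ?lee_fin ?pr_ext_ge0//.
    by apply: step_law_ge0 => // q'; exact: outlaw_next_ge0.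
  rewrite integral_level_sum.
  - apply: eq_level_sum => E sE.
    under eq_integral do rewrite /F /x' /U' half_jointE//.
    rewrite /U'; case: (b); first reflexivity.
    apply: (integral_rewind E (measurable_half_joint false B (E ++ U))) => x.
    exact: half_joint_ge0.
  - by move=> E x; apply: sume_ge0 => p _; apply: sume_ge0 => q _; exact: t0.
  - move=> E; apply: emeasurable_sum => p; apply: emeasurable_sum => q.
    apply: emeasurable_funM.
      apply/measurable_EFinP; apply: measurable_funM; first exact: mQ.
      exact: (measurableT_comp mf (measurable_opos _ _)).
    have mh : measurable_fun [set: Z] (fun y => (pr_ext b k y (U' U E))%:E *
      step_law g b k y (U' U E) q (outlaw_next g B k.+1 y (U' U E)))%E.
      apply: emeasurable_funM; first by apply/measurable_EFinP; exact: measurable_pr_ext.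
      apply: (@measurable_step_law _ _ _ _ _
        (fun y => outlaw_next g B k.+1 y (U' U E))) => // q'.
      exact: measurable_outlaw_next.
    exact: (measurableT_comp mh (mx' E)).
have h0 U : (0 <= \int[nu]_x half_joint k Q b f g B U x)%E.
  by apply: integral_ge0 => x _; exact: half_joint_ge0.
rewrite /U'; case: (b) h0 => h0; first by rewrite -pow2_predD level_sum_cat.
(* The new levels [E] precede [U] in the joined list, so the two sums change places before they
   merge. *)
rewrite -pow2_predDr level_sum_cat level_sum_exchange; first reflexivity.
by move=> E E'; exact: h0.
Qed.

End joint.

Definition next_kernel k Q U x p q : R :=
  (~~ whole_turn k.+1 x U)%:R * union_kernel k Q U x p q.

Definition final_kernel k Q U x p q : R :=
  stop_kernel k Q U x p q + (whole_turn k.+1 x U)%:R * union_kernel k Q U x p q.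

Lemma sum_halves (V : nmodType) k (F : nat -> nat -> V) :
  \sum_(p < 2 ^ k.+1) \sum_(q < 2 ^ k.+1) F p q
  = \sum_b \sum_(p < 2 ^ k) \sum_(q < 2 ^ k)
     (F (off b k + p)%N (off b k + q)%N + F (off b k + p)%N (off (~~ b) k + q)%N).
Proof.
rewrite (sum_pow2S _ (fun p => \sum_(q < 2 ^ k.+1) F p q)) big_bool/=.
congr (_ + _); apply: eq_bigr => p _; rewrite (sum_pow2S _ (F _)) ?big_split//=.
by rewrite addrC.
Qed.

Lemma measurable_whole_turnR k U (b : bool) :
  measurable_fun [set: Z] (fun x => (whole_turn k x U == b)%:R : R).
Proof.
have -> : (fun x => (whole_turn k x U == b)%:R : R)
  = (fun x => if whole_turn k x U then b%:R else (~~ b)%:R).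
  by apply/funext => x; case: ifP; case: (b).
apply: measurable_fun_ifT; [exact: measurable_whole_turn|exact: measurable_cst..].
Qed.

(** Coin [true] supplies the rows [p] in the left half and coin [false] those in the right half;
    together they fill the square array of pairs. Each entry is then split according to whether the
    transition ends in this round. *)
Lemma joint_step k (Q : seq nat -> Z -> nat -> nat -> R) f g B :
  (forall U x p q, 0 <= Q U x p q) ->
  (forall U p q, measurable_fun [set: Z] (fun x => Q U x p q)) ->
  (forall U x p, size U = (2 ^ k).-1 -> (p < 2 ^ k)%N ->
     \sum_(q < 2 ^ k) Q U x p q = (~~ subturn x U 0 k)%:R * oweight x U p) ->
  (forall z, 0 <= f z) -> measurable_fun [set: Z] f ->
  (forall z, 0 <= g z) -> measurable_fun [set: Z] g ->
  (joint k Q f g (true :: B) + joint k Q f g (false :: B)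
   = level_sum (2 ^ k.+1).-1 (fun U => \int[nu]_x
       \sum_(p < 2 ^ k.+1) \sum_(q < 2 ^ k.+1)
         (final_kernel k Q U x p q * (f (opos x U p) * g (opos x U q)))%:E)
     + joint k.+1 (next_kernel k Q) f g B)%E.
Proof.
move=> Q0 mQ Qsum f0 mf g0 mg.
have hj0 := half_joint_ge0 _ Q0 f0 g0.
have mhj := measurable_half_joint _ mQ mf g0 mg.
have int0 b U : (0 <= \int[nu]_x half_joint k Q b f g B U x)%E.
  by apply: integral_ge0 => x _; exact: hj0.
have fk0 U x p q : 0 <= final_kernel k Q U x p q.
  by rewrite addr_ge0 ?stop_kernel_ge0// mulr_ge0 ?union_kernel_ge0.
have nk0 U x p q : 0 <= next_kernel k Q U x p q.
  by rewrite mulr_ge0 ?union_kernel_ge0.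
have F0 U x : (0 <= \sum_(p < 2 ^ k.+1) \sum_(q < 2 ^ k.+1)
    (final_kernel k Q U x p q * (f (opos x U p) * g (opos x U q)))%:E)%E.
  by apply: sume_ge0 => p _; apply: sume_ge0 => q _; rewrite lee_fin mulr_ge0// mulr_ge0.
have N0 U x : (0 <= \sum_(p < 2 ^ k.+1) \sum_(q < 2 ^ k.+1)
    (next_kernel k Q U x p q * f (opos x U p))%:E * outlaw g B k.+1 x U q)%E.
  apply: sume_ge0 => p _; apply: sume_ge0 => q _.
  by rewrite mule_ge0 ?outlaw_ge0// lee_fin mulr_ge0.
have mo h U p : measurable_fun [set: Z] h ->
    measurable_fun [set: Z] (fun x => h (opos x U p) : R).
  by move=> mh; exact: (measurableT_comp mh (measurable_opos _ _)).
rewrite !joint_cons// /joint -!level_sumD//; last 2 first.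
- by move=> U; apply: integral_ge0 => x _; exact: F0.
- by move=> U; apply: integral_ge0 => x _; exact: N0.
apply: eq_level_sum => U sU.
rewrite -ge0_integralD// -[RHS]ge0_integralD//; last 2 first.
- apply: emeasurable_sum => p; apply: emeasurable_sum => q.
  apply/measurable_EFinP; apply: measurable_funM; last by apply: measurable_funM; exact: mo.
  apply: measurable_funD; first exact: measurable_stop_kernel.
  apply: measurable_funM; last exact: measurable_union_kernel.
  by have := measurable_whole_turnR k.+1 U true; under eq_fun do rewrite eqb_id.
- apply: emeasurable_sum => p; apply: emeasurable_sum => q.
  apply: emeasurable_funM; last exact: measurable_outlaw.
  apply/measurable_EFinP; apply: measurable_funM; last exact: mo.
  apply: measurable_funM; last exact: measurable_union_kernel.
  by have := measurable_whole_turnR k.+1 U false; under eq_fun do rewrite eqbF_neg.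
apply: eq_integral => x _.
have key p q : ((stop_kernel k Q U x p q * f (opos x U p) * g (opos x U q))%:E +
     (union_kernel k Q U x p q * f (opos x U p))%:E * outlaw_next g B k.+1 x U q
   = (final_kernel k Q U x p q * (f (opos x U p) * g (opos x U q)))%:E
   + (next_kernel k Q U x p q * f (opos x U p))%:E * outlaw g B k.+1 x U q)%E.
  rewrite /outlaw_next /next_kernel /final_kernel; case: ifP => _.
    by rewrite !mul0r mul0e adde0 -EFinM -EFinD mul1r; congr EFin; ring.
  by rewrite !mul0r addr0 mul1r -mulrA.
rewrite -[RHS]big_split/=.
under [RHS]eq_bigr do rewrite -big_split/=.
rewrite (sum_halves _ (fun p q =>
   ((final_kernel k Q U x p q * (f (opos x U p) * g (opos x U q)))%:E
   + (next_kernel k Q U x p q * f (opos x U p))%:E * outlaw g B k.+1 x U q)%E)).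
rewrite big_bool /half_joint.
have half b : (\sum_(p < 2 ^ k) \sum_(q < 2 ^ k)
    (half_kernel k Q b U x p q * f (opos x U (off b k + p)))%:E *
    step_law g b k x U q (outlaw_next g B k.+1 x U)
   = \sum_(p < 2 ^ k) \sum_(q < 2 ^ k)
     (((final_kernel k Q U x (off b k + p) (off b k + q) *
         (f (opos x U (off b k + p)) * g (opos x U (off b k + q))))%:E
      + (next_kernel k Q U x (off b k + p) (off b k + q) * f (opos x U (off b k + p)))%:E
        * outlaw g B k.+1 x U (off b k + q)%N) +
      ((final_kernel k Q U x (off b k + p) (off (~~ b) k + q) *
         (f (opos x U (off b k + p)) * g (opos x U (off (~~ b) k + q))))%:E
      + (next_kernel k Q U x (off b k + p) (off (~~ b) k + q) *
         f (opos x U (off b k + p)))%:E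
        * outlaw g B k.+1 x U (off (~~ b) k + q)%N)))%E.
  apply: eq_bigr => p _; rewrite step_balance// => [|q]; last exact: outlaw_next_ge0.
  apply: eq_bigr => q _; rewrite -!key stop_kernel_cross// !mul0r add0e.
  by rewrite addeA.
by rewrite !half.
Qed.

Lemma joint_sym n k (Q : seq nat -> Z -> nat -> nat -> R) f g :
  (forall U x p q, 0 <= Q U x p q) ->
  (forall U p q, measurable_fun [set: Z] (fun x => Q U x p q)) ->
  (forall U x p q, Q U x p q = Q U x q p) ->
  (forall U x p, size U = (2 ^ k).-1 -> (p < 2 ^ k)%N ->
     \sum_(q < 2 ^ k) Q U x p q = (~~ subturn x U 0 k)%:R * oweight x U p) ->
  (forall z, 0 <= f z) -> measurable_fun [set: Z] f ->
  (forall z, 0 <= g z) -> measurable_fun [set: Z] g ->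
  coin_sum n (joint k Q f g) = coin_sum n (joint k Q g f).
Proof.
move=> Q0 mQ Qsym Qsum f0 mf g0 mg.
elim: n k Q Q0 mQ Qsym Qsum => [|n IH] k Q Q0 mQ Qsym Qsum /=.
  apply: eq_level_sum => U _; apply: eq_integral => x _.
  rewrite exchange_big/=; apply: eq_bigr => p _; apply: eq_bigr => q _.
  by rewrite Qsym -!EFinM; congr EFin; ring.
rewrite -!coin_sumD.
under eq_coin_sum do rewrite joint_step//.
under [RHS]eq_coin_sum do rewrite joint_step//.
rewrite !coin_sumD; congr (_ + _)%E.
  apply: eq_coin_sum => B; apply: eq_level_sum => U _; apply: eq_integral => x _.
  rewrite exchange_big/=; apply: eq_bigr => p _; apply: eq_bigr => q _.
  rewrite /final_kernel stop_kernel_sym// union_kernel_sym//.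
  by congr EFin; rewrite [f _ * _]mulrC.
apply: IH.
- by move=> U x p q; rewrite mulr_ge0 ?union_kernel_ge0.
- move=> U p q; apply: measurable_funM; last exact: measurable_union_kernel.
  by have := measurable_whole_turnR k.+1 U false; under eq_fun do rewrite eqbF_neg.
- by move=> U x p q; rewrite /next_kernel union_kernel_sym.
- move=> U x p sU pk; rewrite -mulr_sumr union_kernel_sum// mulrA -natrM mulnb.
  (* Surviving both tests on the halves and the U-turn test on the whole is exactly having no
     sub-U-turn, as the row sums of the next round demand. *)
  by rewrite subturnS !add0n !negb_or.
Qed.

End balance.

(** * Volume preservation by shears *)

Section lebesgue_translation.
Context {R : realType}.

Lemma ge0_integral_translation (a : R) (F : R -> \bar R) :
  measurable_fun [set: R] F -> (forall x, (0 <= F x)%E) ->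
  (\int[lebesgue_measure]_x F (x + a)%R = \int[lebesgue_measure]_x F x)%E.
Proof.
move=> mF F0; pose s (x : measurableTypeR R) : measurableTypeR R := (x : R) + a.
have ms : measurable_fun [set: measurableTypeR R] s by exact: measurable_funD.
transitivity (\int[pushforward lebesgue_measure s]_x F x)%E.
  by rewrite ge0_integral_pushforward.
apply: eq_measure_integral => A mA _.
apply/esym/lebesgue_measure_unique => // X [[x y]] /= xy <-.
rewrite /pushforward (_ : _ @^-1` _ = `]x - a, y - a]%classic); last first.
  by apply/seteqP; split => z /=; rewrite !in_itv/= ltrBlDr lerBrDr.
have -> : lebesgue_measure `]x - a, y - a]%classic
    = lebesgue_measure `]x, y]%classic :> \bar R.
  rewrite !lebesgue_measure_itv/= !lte_fin ltrD2r.
  by case: ifPn => // _; rewrite -!EFinB; congr EFin; rewrite opprB addrA subrK.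
by [].
Qed.

Lemma vconsD n (x y : R) (u v : 'cV[R]_n) :
  vcons (x, u) + vcons (y, v) = vcons (x + y, u + v).
Proof. by rewrite /vcons/= (@add_col_mx _ 1) -raddfD. Qed.

Lemma vcons_surj n (c : 'cV[R]_n.+1) : exists x v, c = vcons (x, v).
Proof.
exists ((@usubmx _ 1 n 1 c) 0 0), (@dsubmx _ 1 n 1 c).
by rewrite /vcons/= -mx11_scalar (@vsubmxK _ 1).
Qed.

Lemma measurable_addmx m n (c : 'M[R]_(m, n)) :
  measurable_fun [set: 'M[R]_(m, n)] (fun v : 'M[R]_(m, n) => v + c).
Proof.
apply: measurable_fun_mx => i j; under eq_fun do rewrite mxE.
by apply: measurable_funD => //; exact: measurable_coord.
Qed.

Lemma ge0_integral_lebesgue_vcons n (F : 'cV[R]_n.+1 -> \bar R) :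
  measurable_fun [set: 'cV[R]_n.+1] F -> (forall x, (0 <= F x)%E) ->
  (\int[lebesgue_vec n.+1]_v F v =
   \int[lebesgue_measure]_x \int[lebesgue_vec n]_v F (vcons (x, v)))%E.
Proof.
move=> mF F0.
rewrite ge0_integral_pushforward//; last exact: measurable_vcons.
rewrite fubini_tonelli1//; last by move=> z; exact: F0.
by apply: measurableT_comp => //; exact: measurable_vcons.
Qed.

(** The measure is built coordinate by coordinate, so Tonelli splits off the first coordinate and
    reduces the claim to the line. *)
Lemma lebesgue_vec_translation n (c : 'cV[R]_n) (F : 'cV[R]_n -> \bar R) :
  measurable_fun [set: 'cV[R]_n] F -> (forall x, (0 <= F x)%E) ->
  (\int[lebesgue_vec n]_v F (v + c)%R = \int[lebesgue_vec n]_v F v)%E.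
Proof.
elim: n c F => [|n IH] c F mF F0.
  by apply: eq_integral => v _; congr F; apply/colP => -[].
have [a [u ->]] := vcons_surj c.
rewrite !ge0_integral_lebesgue_vcons//; last first.
  by apply: measurableT_comp => //; exact: measurable_addmx.
have mFv : measurable_fun setT (F \o @vcons R n).
  by apply: measurableT_comp => //; exact: measurable_vcons.
under eq_integral do under eq_integral do rewrite vconsD.
rewrite -[RHS](ge0_integral_translation a); last 2 first.
- apply: (measurable_fun_fubini_tonelli_F (m2 := lebesgue_vec n)
    (F \o @vcons R n)) => // z; exact: F0.
- by move=> x; exact: integral_ge0.
apply: eq_integral => x _.
rewrite (IH u (fun v => F (vcons (x + a, v))))//.
exact: (@measurableT_comp _ _ _ _ _ _ (F \o @vcons R n) _ (pair (x + a))).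
Qed.

End lebesgue_translation.

Section shear.
Context {R : realType} {n : nat}.
Local Notation phase := ('cV[R]_n * 'cV[R]_n)%type.

Definition lebesgue_phase : {measure set phase -> \bar R} :=
  (lebesgue_vec n \x lebesgue_vec n)%E.

Lemma ge0_integral_lebesgue_phase (F : phase -> \bar R) :
  measurable_fun [set: phase] F -> (forall z, (0 <= F z)%E) ->
  (\int[lebesgue_phase]_z F z =
   \int[lebesgue_vec n]_x \int[lebesgue_vec n]_y F (x, y))%E.
Proof. by move=> mF F0; rewrite fubini_tonelli1. Qed.

(** For a fixed position the momentum is translated by a constant vector, so only measurability of
    the map is asked for. *)
Lemma integral_kick (k : 'cV[R]_n -> 'cV[R]_n) (F : phase -> \bar R) :
  measurable_fun [set: phase] (fun z : phase => (z.1, z.2 + k z.1)) ->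
  measurable_fun [set: phase] F -> (forall z, (0 <= F z)%E) ->
  (\int[lebesgue_phase]_z F (z.1, z.2 + k z.1)%R = \int[lebesgue_phase]_z F z)%E.
Proof.
move=> mk mF F0; rewrite !fubini_tonelli1//; last exact: measurableT_comp mk.
apply: eq_integral => x _; rewrite /fubini_F /=.
rewrite (lebesgue_vec_translation (k x) (F := fun y => F (x, y)))//.
exact: measurable_fun_pair2.
Qed.

Lemma integral_drift (k : 'cV[R]_n -> 'cV[R]_n) (F : phase -> \bar R) :
  measurable_fun [set: phase] (fun z : phase => (z.1 + k z.2, z.2)) ->
  measurable_fun [set: phase] F -> (forall z, (0 <= F z)%E) ->
  (\int[lebesgue_phase]_z F (z.1 + k z.2, z.2)%R = \int[lebesgue_phase]_z F z)%E.
Proof.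
move=> mk mF F0; rewrite !fubini_tonelli2//; last exact: measurableT_comp mk.
apply: eq_integral => y _; rewrite /fubini_G /=.
rewrite (lebesgue_vec_translation (k y) (F := fun x => F (x, y)))//.
exact: measurable_fun_pair1.
Qed.

End shear.

(** * The leapfrog map *)

Section measurable_matrix.
Context {R : realType} {dT} {T : measurableType dT}.

Lemma measurable_mxE m n (f : T -> 'M[R]_(m, n)) i j :
  measurable_fun [set: T] f -> measurable_fun [set: T] (fun t => f t i j).
Proof. by move=> mf; exact: (measurableT_comp (measurable_coord i j) mf). Qed.

Lemma measurable_addmxf m n (f g : T -> 'M[R]_(m, n)) :
  measurable_fun [set: T] f -> measurable_fun [set: T] g ->
  measurable_fun [set: T] (fun t => f t + g t).
Proof.
move=> mf mg; apply: measurable_fun_mx => i j; under eq_fun do rewrite mxE.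
by apply: measurable_funD; exact: measurable_mxE.
Qed.

Lemma measurable_oppmxf m n (f : T -> 'M[R]_(m, n)) :
  measurable_fun [set: T] f -> measurable_fun [set: T] (fun t => - f t).
Proof.
move=> mf; apply: measurable_fun_mx => i j; under eq_fun do rewrite mxE.
by apply: measurable_funN; exact: measurable_mxE.
Qed.

Lemma measurable_scalemxf m n (c : R) (f : T -> 'M[R]_(m, n)) :
  measurable_fun [set: T] f -> measurable_fun [set: T] (fun t => c *: f t).
Proof.
move=> mf; apply: measurable_fun_mx => i j; under eq_fun do rewrite mxE.
by apply: measurable_funM => //; exact: measurable_mxE.
Qed.

Lemma measurable_trmxf m n (f : T -> 'M[R]_(m, n)) :
  measurable_fun [set: T] f -> measurable_fun [set: T] (fun t => (f t)^T).
Proof.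
move=> mf; apply: measurable_fun_mx => i j; under eq_fun do rewrite mxE.
exact: measurable_mxE.
Qed.

Lemma measurable_mulmxf m n p (f : T -> 'M[R]_(m, n)) (g : T -> 'M[R]_(n, p)) :
  measurable_fun [set: T] f -> measurable_fun [set: T] g ->
  measurable_fun [set: T] (fun t => f t *m g t).
Proof.
move=> mf mg; apply: measurable_fun_mx => i j; under eq_fun do rewrite mxE.
by apply: measurable_sum => k; apply: measurable_funM; exact: measurable_mxE.
Qed.

Lemma measurable_mulmxfl m n p (A : 'M[R]_(m, n)) (g : T -> 'M[R]_(n, p)) :
  measurable_fun [set: T] g -> measurable_fun [set: T] (fun t => A *m g t).
Proof. by move=> mg; apply: measurable_mulmxf => //; exact: measurable_cst. Qed.

Lemma continuous_measurable_mx m n (f : 'M[R]_(m, n) -> R) :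
  continuous f -> measurable_fun [set: 'M[R]_(m, n)] f.
Proof.
move=> cf.
apply: (@measurability _ _ _ _ _ _ _ (measurable_realfun.RGenOpens.measurableE R)).
move=> _ [_ [a [b ->]] <-]; rewrite setTI; apply: sub_sigma_algebra.
by apply: open_comp; last exact: interval_open.
Qed.

Lemma measurable_bigmax (I : Type) (s : seq I) (f0 : T -> R) (f : I -> T -> R) :
  measurable_fun [set: T] f0 -> (forall i, measurable_fun [set: T] (f i)) ->
  measurable_fun [set: T] (fun t => \big[Num.max/f0 t]_(i <- s) f i t).
Proof.
move=> mf0 mf; elim: s => [|i s IH]; first by under eq_fun do rewrite big_nil.
by under eq_fun do rewrite big_cons; exact: measurable_maxr.
Qed.

Lemma measurable_bigmin (I : Type) (s : seq I) (f0 : T -> R) (f : I -> T -> R) :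
  measurable_fun [set: T] f0 -> (forall i, measurable_fun [set: T] (f i)) ->
  measurable_fun [set: T] (fun t => \big[Num.min/f0 t]_(i <- s) f i t).
Proof.
move=> mf0 mf; elim: s => [|i s IH]; first by under eq_fun do rewrite big_nil.
by under eq_fun do rewrite big_cons; exact: measurable_minr.
Qed.

Lemma measurable_first_true (P : nat -> T -> bool) (first : T -> nat) :
  (forall n, measurable_fun [set: T] (P n)) ->
  (forall t, P (first t) t) -> (forall t n, P n t -> (first t <= n)%N) ->
  measurable_fun [set: T] first.
Proof.
move=> mP Pf minf _ Y _; rewrite setTI.
have -> : first @^-1` Y = \bigcup_(n in Y) (P n @^-1` [set true] `&`
    \bigcap_(m in [set m | (m < n)%N]) P m @^-1` [set false]).
  apply/seteqP; split => [t Yt|t [n Yn [/= Pn Pm]]].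
    exists (first t) => //; split => [|m /= mt]; first exact: Pf.
    by apply/negbTE/negP => /minf; rewrite leqNgt mt.
  rewrite /preimage/=; suff -> : first t = n by [].
  apply/eqP; rewrite eqn_leq minf//= leqNgt; apply/negP => /Pm /=.
  by rewrite Pf.
apply: bigcup_measurable => n _; apply: measurableI.
  by rewrite -[X in measurable X]setTI; apply: mP.
apply: bigcap_measurableType => m _.
by rewrite -[X in measurable X]setTI; apply: mP.
Qed.

End measurable_matrix.

Section gradient.
Context {R : realType} {d : nat}.
Variable mu : 'cV[R]_d -> R.
Hypotheses (mu_gt0 : forall x, 0 < mu x) (mu_C1 : continuously_differentiable mu).

Lemma gradient_ln x : gradient (fun x => ln (mu x)) x = (mu x)^-1 *: gradient mu x.
Proof.
have dmu := mu_C1.1 x.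
have dln : differentiable (@ln R) (mu x).
  by apply/derivable1_diffP; have [] := is_derive1_ln (mu_gt0 x).
apply/colP => i; rewrite !mxE !deriveE//; last exact: differentiable_comp.
rewrite -[fun _ => _]/(@ln R \o mu) diff_comp//=.
set v := 'd mu x _.
rewrite -[v in LHS]mulr1 -[v * 1]/(v *: (1 : R)) linearZ/= -deriveE//.
rewrite -derive1E derive1E; have [_ ->] := is_derive1_ln (mu_gt0 x).
by rewrite /GRing.scale/= mulrC.
Qed.

Lemma measurable_mu : measurable_fun [set: 'cV[R]_d] mu.
Proof.
apply: continuous_measurable_mx => x.
exact/differentiable_continuous/(mu_C1.1 x).
Qed.

Lemma measurable_grad_log : measurable_fun [set: 'cV[R]_d] (grad_log mu).
Proof.
rewrite /grad_log; under eq_fun do rewrite gradient_ln.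
apply: measurable_fun_mx => i j; under eq_fun do rewrite mxE.
apply: measurable_funM.
  under eq_fun do rewrite -powR_inv1 ?(ltW (mu_gt0 _))//.
  exact: (measurableT_comp (measurable_powR _) measurable_mu).
apply: continuous_measurable_mx => x.
apply: (@continuous_comp _ _ _ (gradient mu) (fun A : 'cV[R]_d => A i j)).
  exact: mu_C1.2.
exact: coord_continuous.
Qed.

End gradient.

(** * Kick-drift-kick splitting: time reversal and volume *)

Section leapfrog.
Context {R : realType} {d : nat}.
Variables (mu : 'cV[R]_d -> R) (M : 'M[R]_d).
Local Notation phase := ('cV[R]_d * 'cV[R]_d)%type.
Hypothesis mg : measurable_fun [set: 'cV[R]_d] (grad_log mu).

Definition kick (s : R) (z : phase) : phase := (z.1, z.2 + (s / 2) *: grad_log mu z.1).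
Definition drift (s : R) (z : phase) : phase := (z.1 + s *: (invmx M *m z.2), z.2).

(** The term with s^2 / 2 in the new position is the drift of the momentum gained in the first half
    kick. *)
Lemma leapfrogE s z : leapfrog mu M s z = kick s (drift s (kick s z)).
Proof.
rewrite /leapfrog /kick /drift /=.
have -> : invmx M *m (s *: z.2 + (s ^+ 2 / 2) *: grad_log mu z.1)
    = s *: (invmx M *m (z.2 + (s / 2) *: grad_log mu z.1)).
  rewrite scalemxAr; congr (_ *m _).
  by rewrite scalerDr scalerA expr2 mulrA.
by rewrite scalerDr addrA.
Qed.

Lemma measurable_kick s : measurable_fun [set: phase] (kick s).
Proof.
apply: measurable_fun_pair => /=; first exact: measurable_fst.
apply: measurable_addmxf; first exact: measurable_snd.
by apply: measurable_scalemxf; exact: (measurableT_comp mg measurable_fst).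
Qed.

Lemma measurable_drift s : measurable_fun [set: phase] (drift s).
Proof.
apply: measurable_fun_pair => /=; last exact: measurable_snd.
apply: measurable_addmxf; first exact: measurable_fst.
by apply: measurable_scalemxf; apply: measurable_mulmxfl; exact: measurable_snd.
Qed.

Lemma measurable_leapfrog s : measurable_fun [set: phase] (leapfrog mu M s).
Proof.
have -> : leapfrog mu M s = kick s \o (drift s \o kick s).
  by apply/funext => z; exact: leapfrogE.
apply: measurableT_comp; first exact: measurable_kick.
by apply: measurableT_comp; [exact: measurable_drift|exact: measurable_kick].
Qed.

Lemma flipK : involutive (@flip R d).
Proof. by case=> t r; rewrite /flip/= opprK. Qed.

Lemma measurable_flip : measurable_fun [set: phase] (@flip R d).
Proof.
apply: measurable_fun_pair => /=; first exact: measurable_fst.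
by apply: measurable_oppmxf; exact: measurable_snd.
Qed.

Lemma kick_flip s z : kick s (flip (kick s z)) = flip z.
Proof. by rewrite /kick /flip/= opprD subrK. Qed.

Lemma drift_flip s z : drift s (flip (drift s z)) = flip z.
Proof. by rewrite /drift /flip/= mulmxN scalerN addrK. Qed.

(** Each shear S satisfies S o flip o S = flip, and the composition kick-drift-kick is a palindrome,
    so the factors cancel from the inside outwards. *)
Lemma leapfrog_flip s z : leapfrog mu M s (flip (leapfrog mu M s z)) = flip z.
Proof. by rewrite !leapfrogE kick_flip drift_flip kick_flip. Qed.

Lemma iter_leapfrog_flip s n z :
  iter n (leapfrog mu M s) (flip (iter n (leapfrog mu M s) z)) = flip z.
Proof.
elim: n z => [|n IH] z //=.
by rewrite -iterS iterSr leapfrog_flip IH.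
Qed.

Lemma measurable_iter_leapfrog s n : measurable_fun [set: phase] (iter n (leapfrog mu M s)).
Proof.
elim: n => [|n IH] /=; first exact: measurable_id.
exact: (measurableT_comp (measurable_leapfrog s) IH).
Qed.

Lemma integral_leapfrog s (F : phase -> \bar R) :
  measurable_fun [set: phase] F -> (forall z, (0 <= F z)%E) ->
  (\int[lebesgue_phase]_z F (leapfrog mu M s z) = \int[lebesgue_phase]_z F z)%E.
Proof.
move=> mF F0; under eq_integral do rewrite leapfrogE.
have mk := measurable_kick s; have md := measurable_drift s.
have mFk : measurable_fun [set: phase] (F \o kick s) by exact: measurableT_comp.
have mFkd : measurable_fun [set: phase] (F \o kick s \o drift s) by exact: measurableT_comp.
transitivity (\int[lebesgue_phase]_z (F \o kick s \o drift s) z)%E.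
  apply: (integral_kick (k := fun x => (s / 2) *: grad_log mu x) mk mFkd) => z.
  exact: F0.
transitivity (\int[lebesgue_phase]_z (F \o kick s) z)%E.
  apply: (integral_drift (k := fun r => s *: (invmx M *m r)) md mFk) => z.
  exact: F0.
exact: (integral_kick (k := fun x => (s / 2) *: grad_log mu x) mk mF F0).
Qed.

Lemma integral_iter_leapfrog s n (F : phase -> \bar R) :
  measurable_fun [set: phase] F -> (forall z, (0 <= F z)%E) ->
  (\int[lebesgue_phase]_z F (iter n (leapfrog mu M s) z) = \int[lebesgue_phase]_z F z)%E.
Proof.
move=> mF F0; elim: n => //= n <-.
rewrite -(integral_leapfrog s (F := fun z => F (iter n (leapfrog mu M s) z)))//.
  by apply: eq_integral => z _; rewrite -iterSr.
by apply: measurableT_comp => //; exact: measurable_iter_leapfrog.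
Qed.

End leapfrog.

(** * The transition kernel *)

Section instance.
Context {R : realType} {d : nat}.
Variables (mu : 'cV[R]_d -> R) (M : 'M[R]_d) (h delta : R).
Variable p_micro : nat -> nat -> R.
Local Notation phase := ('cV[R]_d * 'cV[R]_d)%type.
Hypotheses (mu_gt0 : forall x, 0 < mu x) (mu_C1 : continuously_differentiable mu)
  (p_micro_ge0 : forall n l, 0 <= p_micro (2 ^ n)%N l)
  (micro_exists : forall z, exists n, micro_ok mu M h delta z n).

(** The sums over levels include [l = 0], where this is the identity; invertibility and volume
    preservation therefore hold for every [l]. *)
Definition macro l (z : phase) : phase := micro_steps mu M h l l z.
Definition macro_inv l (z : phase) : phase := flip (macro l (flip z)).
Definition p_fwd l z : R := p_micro (micro mu M h delta z) l.
Definition p_bwd l z : R := p_micro (micro mu M h delta (flip z)) l.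
Definition gibbs z : R := expR (- hamiltonian mu M z).
Definition uturn (z z' : phase) : bool :=
  Num.min ((z.2^T *m invmx M *m (z'.1 - z.1)) ord0 ord0)
          ((z'.2^T *m invmx M *m (z'.1 - z.1)) ord0 ord0) < 0.

Lemma macroK l z : macro_inv l (macro l z) = z.
Proof. by rewrite /macro_inv /macro /micro_steps iter_leapfrog_flip flipK. Qed.

Lemma macro_invK l z : macro l (macro_inv l z) = z.
Proof. by rewrite /macro_inv /macro /micro_steps iter_leapfrog_flip flipK. Qed.

Let mg : measurable_fun [set: 'cV[R]_d] (grad_log mu).
Proof. exact: measurable_grad_log. Qed.

Lemma measurable_macro l : measurable_fun [set: phase] (macro l).
Proof. exact: measurable_iter_leapfrog. Qed.

Lemma measurable_macro_inv l : measurable_fun [set: phase] (macro_inv l).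
Proof.
apply: (measurableT_comp (@measurable_flip R d)).
exact: (measurableT_comp (measurable_macro l) (@measurable_flip R d)).
Qed.

Lemma integral_macro l (F : phase -> \bar R) :
  measurable_fun [set: phase] F -> (forall z, (0 <= F z)%E) ->
  (\int[lebesgue_phase]_z F (macro l z) = \int[lebesgue_phase]_z F z)%E.
Proof. exact: integral_iter_leapfrog. Qed.

(** Starts the induction over doublings: by strictness of the inequality an orbit of a single state
    has no sub-U-turn. *)
Lemma uturnxx z : uturn z z = false.
Proof. by rewrite /uturn subrr !mulmx0 !mxE minxx ltxx. Qed.

Lemma measurable_uturn (f g : phase -> phase) :
  measurable_fun [set: phase] f -> measurable_fun [set: phase] g ->
  measurable_fun [set: phase] (fun z => uturn (f z) (g z)).
Proof.
move=> mf mg'.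
have m1 k : measurable_fun [set: phase] k ->
    measurable_fun [set: phase] (fun z => (k z : phase).1).
  by move=> mk; exact: (measurableT_comp measurable_fst mk).
have m2 k : measurable_fun [set: phase] k ->
    measurable_fun [set: phase] (fun z => (k z : phase).2).
  by move=> mk; exact: (measurableT_comp measurable_snd mk).
have mq k : measurable_fun [set: phase] k -> measurable_fun [set: phase]
    (fun z => ((k z : phase).2^T *m invmx M *m ((g z).1 - (f z).1)) ord0 ord0).
  move=> mk; apply: measurable_mxE; apply: measurable_mulmxf.
    apply: measurable_mulmxf; last exact: measurable_cst.
    by apply: measurable_trmxf; exact: m2.
  by apply: measurable_addmxf; [exact: m1|apply: measurable_oppmxf; exact: m1].
apply: measurable_fun_ltr; last exact: measurable_cst.
by apply: measurable_minr; exact: mq.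
Qed.

Lemma measurable_hamiltonian : measurable_fun [set: phase] (hamiltonian mu M).
Proof.
apply: measurable_funD.
  apply: measurable_funN; apply: (measurableT_comp (@measurable_ln R)).
  exact: (measurableT_comp (measurable_mu mu_C1) measurable_fst).
apply: measurable_funM; last exact: measurable_cst.
apply: measurable_mxE; apply: measurable_mulmxf; last exact: measurable_snd.
apply: measurable_mulmxf; last exact: measurable_cst.
by apply: measurable_trmxf; exact: measurable_snd.
Qed.

Lemma measurable_gibbs : measurable_fun [set: phase] gibbs.
Proof.
apply: (measurableT_comp (@measurable_expR R)).
by apply: measurable_funN; exact: measurable_hamiltonian.
Qed.

Lemma gibbs_gt0 z : 0 < gibbs z.
Proof. exact: expR_gt0. Qed.

Lemma measurable_micro_ok n :
  measurable_fun [set: phase] (fun z => micro_ok mu M h delta z n).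
Proof.
have mH j : measurable_fun [set: phase]
    (fun z => hamiltonian mu M (micro_steps mu M h (2 ^ n) j z)).
  apply: (measurableT_comp measurable_hamiltonian).
  exact: measurable_iter_leapfrog.
apply: measurable_fun_ler; last exact: measurable_cst.
apply: measurable_funB.
  by apply: measurable_bigmax => [|j]; [exact: measurable_hamiltonian|exact: mH].
by apply: measurable_bigmin => [|j]; [exact: measurable_hamiltonian|exact: mH].
Qed.

(** Nonnegativity of [p_micro] is available only at powers of 2; the default value 1 is one of
    them. *)
Lemma micro_pow2 z : exists n, micro mu M h delta z = (2 ^ n)%N.
Proof. by rewrite /micro; case: pselect => [ex|_]; [exists (ex_minn ex)|exists 0%N]. Qed.

Lemma measurable_p_fwd l : measurable_fun [set: phase] (p_fwd l).
Proof.
pose first z := ex_minn (micro_exists z).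
have -> : p_fwd l = (fun n => p_micro (2 ^ n)%N l) \o first.
  apply/funext => z; rewrite /p_fwd /micro/= /first; case: pselect => // ex.
  (* [ex_minn] takes the existence proof as an argument, and [pselect] supplies one other than
     [micro_exists]. *)
  by rewrite (Prop_irrelevance ex (micro_exists z)).
have mfirst : measurable_fun [set: phase] first.
  apply: (measurable_first_true measurable_micro_ok) => [z|z n].
    by rewrite /first; case: ex_minnP.
  by rewrite /first; case: ex_minnP => m _ + /[dup] zn => /[apply].
exact: (@measurableT_comp _ _ _ _ _ _ (fun n => p_micro (2 ^ n)%N l) _ first).
Qed.

Lemma measurable_p_bwd l : measurable_fun [set: phase] (p_bwd l).
Proof. exact: (measurableT_comp (measurable_p_fwd l) (@measurable_flip R d)). Qed.

Lemma p_fwd_ge0 l z : 0 <= p_fwd l z.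
Proof. by rewrite /p_fwd; have [n ->] := micro_pow2 z. Qed.

Lemma p_bwd_ge0 l z : 0 <= p_bwd l z.
Proof. exact: p_fwd_ge0. Qed.

(** * Trajectories of the algorithm as orbits *)

Local Notation opos := (opos macro).
Local Notation rewind := (rewind macro_inv).
Local Notation oweight := (oweight macro p_fwd p_bwd gibbs).
Local Notation bweight := (bweight macro p_fwd p_bwd gibbs).
Local Notation pr_fwd := (pr_fwd macro p_fwd).
Local Notation pr_bwd := (pr_bwd macro p_bwd).
Local Notation pr_ext := (pr_ext macro p_fwd p_bwd).
Local Notation subturn := (subturn macro uturn).
Local Notation accept := (accept macro p_fwd p_bwd gibbs).
Local Notation step_law := (step_law macro p_fwd p_bwd gibbs uturn).
Local Notation whole_turn := (whole_turn macro uturn).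
Local Notation outlaw := (outlaw macro macro_inv p_fwd p_bwd gibbs uturn).
Local Notation traj := (@trajectory R d).
Local Notation weight := (weight mu M h delta p_micro).
Local Notation extend_forward := (extend_forward mu M h delta p_micro).
Local Notation extend_backward := (extend_backward mu M h delta p_micro).
Local Notation step_forward := (step_forward mu M h).
Local Notation step_backward := (step_backward mu M h).
Local Notation doubling := (doubling mu M h delta p_micro).

(** Constrains only the entries generated so far. Position [j] of the orbit is index [a + j], so the
    start, at index 0, has position [- a]. *)
Definition represents (t : traj) (a : int) (x : phase) (U : seq nat) : Prop :=
  (forall j, (j <= size U)%N -> tpos t (a + j%:Z) = opos x U j) /\
  (forall j, (j < size U)%N -> tlev t (a + j%:Z) = nth 0%N U j).

Lemma represents_forward t a x U l : represents t a x U ->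
  represents (step_forward t (a + (size U)%:Z) l) a x (rcons U l).
Proof.
move=> [tp tl]; split => j; rewrite size_rcons => jU /=.
  have [->|ju] := eqVneq j (size U).+1.
    rewrite ifT; last by apply/eqP; lia.
    rewrite oposS ?size_rcons// nth_rcons ltnn eqxx -cats1 opos_catl// tp//.
  rewrite ifF; last by apply/eqP; lia.
  by rewrite -cats1 opos_catl ?tp//; lia.
rewrite nth_rcons; have [->|ju] := eqVneq j (size U); first by rewrite ltnn !eqxx.
have jlt : (j < size U)%N by lia.
by rewrite jlt ifF ?tl//; apply/eqP; lia.
Qed.

Lemma represents_backward t a x U l : represents t a x U ->
  represents (step_backward t (a - 1) l) (a - 1) (macro_inv l x) (l :: U).
Proof.
move=> [tp tl]; have a0 := tp 0%N (leq0n _); rewrite addr0 opos0 in a0.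
split => -[|j] jU /=.
- by rewrite addr0 eqxx subrK a0 opos0.
- rewrite ifF; last by apply/eqP; lia.
  have -> : a - 1 + j.+1%:Z = a + j%:Z by lia.
  rewrite tp//; have := opos_catr macro (macro_inv l x) [:: l] U j.
  rewrite /= add1n => ->; congr (opos _ _ _).
  by rewrite /opos /= take0 /= macro_invK.
- by rewrite addr0 eqxx.
- rewrite ifF; last by apply/eqP; lia.
  have -> : a - 1 + j.+1%:Z = a + j%:Z by lia.
  exact: tl.
Qed.

Fixpoint forward_traj (t : traj) (b : int) (E : seq nat) : traj :=
  if E is l :: E' then forward_traj (step_forward t b l) (b + 1) E' else t.

(* The levels of a backward extension are generated from the last to the first. *)
Fixpoint backward_traj (t : traj) (a : int) (E : seq nat) : traj :=
  if E is l :: E' then backward_traj (step_backward t (a - 1) l) (a - 1) E' else t.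

Lemma represents_forward_traj t a x U E : represents t a x U ->
  represents (forward_traj t (a + (size U)%:Z) E) a x (U ++ E).
Proof.
elim: E t U => [|l E IH] t U tU /=; first by rewrite cats0.
rewrite -cat_rcons; have := IH _ _ (represents_forward l tU).
by rewrite size_rcons (_ : a + (size U).+1%:Z = a + (size U)%:Z + 1)//; lia.
Qed.

Lemma represents_backward_traj t a x U E : represents t a x U ->
  represents (backward_traj t a (rev E)) (a - (size E)%:Z) (rewind x E) (E ++ U).
Proof.
elim/last_ind: E t a x U => [|E l IH] t a x U tU /=; first by rewrite subr0.
rewrite rev_rcons /= cat_rcons size_rcons /rewind foldr_rcons.
have := IH _ _ _ _ (represents_backward l tU).
by rewrite (_ : a - 1 - (size E)%:Z = a - (size E).+1%:Z)//; lia.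
Qed.

Lemma extend_forwardE n t b (F : traj -> \bar R) : (forall t, (0 <= F t)%E) ->
  extend_forward n t b F
  = level_sum n (fun E => (pr_fwd (tpos t b) E 0 (size E))%:E * F (forward_traj t b E))%E.
Proof.
move=> F0; elim: n t b => [|n IH] t b /=.
  by rewrite /pr_fwd big_geq// mul1e.
rewrite /bind /pmf_law; apply: eq_eseriesr => l _.
rewrite IH -level_sumZ => [|E]; last first.
  by rewrite mule_ge0// lee_fin pr_fwd_ge0// => *; exact: p_fwd_ge0.
apply: eq_level_sum => E _; rewrite muleA -EFinM; congr (_%:E * _)%E.
by rewrite /= eqxx [RHS]/(pr_fwd _ _ _ _) big_nat_recl//= opos0.
Qed.

(** [E] is in left-to-right order but is drawn from the right, hence [rev E]. Since [macro] undoes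
    [macro_inv], the states visited backward are those of the orbit read forward from its rewound
    left end, so the draws form a [pr_bwd]. *)
Lemma extend_backwardE n t a (F : traj -> \bar R) : (forall t, (0 <= F t)%E) ->
  extend_backward n t a F
  = level_sum n (fun E => (pr_bwd (rewind (tpos t a) E) E 0 (size E))%:E *
                          F (backward_traj t a (rev E)))%E.
Proof.
move=> F0; have G0 t' a' E : (0 <= (pr_bwd (rewind (tpos t' a') E) E 0 (size E))%:E *
                          F (backward_traj t' a' (rev E)))%E.
  by rewrite mule_ge0// lee_fin pr_bwd_ge0// => *; exact: p_bwd_ge0.
elim: n t a => [|n IH] t a; first by rewrite /= /pr_bwd big_geq// mul1e.
rewrite level_sumSr//= /bind /pmf_law; apply: eq_eseriesr => l _.
rewrite IH -level_sumZ => [|E]; last exact: G0.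
apply: eq_level_sum => E _; rewrite rev_rcons /= muleA -EFinM; congr (_%:E * _)%E.
rewrite /= eqxx subrK /rewind foldr_rcons size_rcons [RHS]/(pr_bwd _ _ _ _).
rewrite big_nat_recr//= mulrC; congr (_ * _).
  by apply: eq_big_nat => i /andP[_ iE]; rewrite nth_rcons iE -cats1 opos_catl.
rewrite nth_rcons ltnn eqxx /p_bwd; congr (p_micro (micro _ _ _ _ (flip _)) _).
rewrite oposS ?size_rcons// nth_rcons ltnn eqxx -cats1.
by rewrite (opos_rewind _ _ _ macro_invK) macro_invK.
Qed.

(** Moving the start from [j] to [j.+1] turns step [j] from a forward into a backward draw. This is
    the recursion of the algorithm's weights, cleared of denominators that may vanish. *)
Lemma oweightS x U j : (j < size U)%N ->
  oweight x U j * (gibbs (opos x U j.+1) * p_bwd (nth 0%N U j) (opos x U j.+1))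
  = oweight x U j.+1 * (gibbs (opos x U j) * p_fwd (nth 0%N U j) (opos x U j)).
Proof.
move=> jU; rewrite /oweight [pr_bwd x U 0 j.+1]/(pr_bwd _ _ _ _) big_nat_recr//=.
rewrite [pr_fwd x U j _]/(pr_fwd _ _ _ _) big_ltn//= -/(pr_bwd _ _ _ _) -/(pr_fwd _ _ _ _).
by ring.
Qed.

(** A nonzero weight at [p] means that every draw made when growing the orbit from [p] has positive
    probability; for steps to the right these are the denominators in the recursion of the
    weights. *)
Lemma oweight_fwd_neq0 x U p j : oweight x U p != 0 -> (p <= j < size U)%N ->
  p_fwd (nth 0%N U j) (opos x U j) != 0.
Proof.
rewrite !mulf_eq0 !negb_or => /andP[_ +] /andP[pj jU]; apply: contraNneq => p0.
rewrite /pr_fwd (@big_cat_nat _ _ _ j)//= ?(ltnW jU)//.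
by rewrite [X in _ * X]big_ltn//= p0 mul0r mulr0.
Qed.

Lemma oweight_bwd_neq0 x U p j : oweight x U p != 0 -> (j < p)%N ->
  p_bwd (nth 0%N U j) (opos x U j.+1) != 0.
Proof.
rewrite !mulf_eq0 !negb_or => /andP[/andP[_ +] _] jp; apply: contraNneq => p0.
rewrite /pr_bwd (@big_cat_nat _ _ _ j)//= ?(ltnW jp)//.
by rewrite [X in _ * X]big_ltn//= p0 mul0r mulr0.
Qed.

(** * Weights of the algorithm compared with orbit weights *)

Section weights.
Variables (t : traj) (x : phase) (U : seq nat) (p : nat).
Hypotheses (tU : represents t (- p%:Z) x U) (pU : (p <= size U)%N).
Hypothesis Vp : oweight x U p != 0.

Lemma weight_forwardE n : (p + n <= size U)%N ->
  weight_forward mu M h delta p_micro t n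
  = gibbs (opos x U p) / oweight x U p * oweight x U (p + n).
Proof.
have [tp tl] := tU; elim: n => [|n IH] pn /=.
  rewrite addn0 divfK// /boltzmann; have := tp p pU.
  by rewrite addNr => ->.
rewrite IH; last by lia.
have jU : (p + n < size U)%N by lia.
have e1 : - p%:Z + (p + n)%:Z = n%:Z by lia.
have e2 : - p%:Z + (p + n).+1%:Z = n.+1%:Z by lia.
have t1 := tp _ (ltnW jU); have t2 := tp _ jU; have t3 := tl _ jU.
rewrite e1 in t1; rewrite e2 in t2; rewrite e1 in t3.
have e3 : n%:Z + 1 = n.+1%:Z by lia.
rewrite /boltzmann /p_minus /p_plus e3 t1 t2 t3 -!/(gibbs _).
rewrite -/(p_fwd (nth 0%N U (p + n)) (opos x U (p + n))).
rewrite -/(p_bwd (nth 0%N U (p + n)) (opos x U (p + n).+1)).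
have ppos : p_fwd (nth 0%N U (p + n)) (opos x U (p + n)) != 0.
  by apply: (oweight_fwd_neq0 Vp); rewrite leq_addr.
have g0 : gibbs (opos x U (p + n)) != 0 by rewrite gt_eqF ?gibbs_gt0.
rewrite addnS -[oweight x U (p + n).+1](mulfK (mulf_neq0 g0 ppos)) -oweightS//.
by field; rewrite Vp g0 ppos.
Qed.

Lemma weight_backwardE n : (n <= p)%N ->
  weight_backward mu M h delta p_micro t n
  = gibbs (opos x U p) / oweight x U p * oweight x U (p - n).
Proof.
have [tp tl] := tU; elim: n => [|n IH] np /=.
  rewrite subn0 divfK// /boltzmann; have := tp p pU.
  by rewrite addNr => ->.
rewrite IH; last by lia.
have [j pj] : exists j, (p - n = j.+1)%N by exists (p - n.+1)%N; lia.
have pj' : (p - n.+1 = j)%N by lia.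
have jp : (j < p)%N by lia.
have jU : (j < size U)%N by lia.
have e1 : - p%:Z + j%:Z = - n.+1%:Z by lia.
have e2 : - p%:Z + j.+1%:Z = - n%:Z by lia.
have t1 := tp _ (ltnW jU); have t2 := tp _ jU; have t3 := tl _ jU.
rewrite e1 in t1; rewrite e2 in t2; rewrite e1 in t3.
have e3 : - n.+1%:Z + 1 = - n%:Z by lia.
rewrite /boltzmann /p_minus /p_plus e3 t1 t2 t3 -!/(gibbs _) pj pj'.
rewrite -/(p_fwd (nth 0%N U j) (opos x U j)).
rewrite -/(p_bwd (nth 0%N U j) (opos x U j.+1)).
have ppos : p_bwd (nth 0%N U j) (opos x U j.+1) != 0 by exact: (oweight_bwd_neq0 Vp).
have g0 : gibbs (opos x U j.+1) != 0 by rewrite gt_eqF ?gibbs_gt0.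
rewrite -[oweight x U j](mulfK (mulf_neq0 g0 ppos)) oweightS//.
by field; rewrite Vp g0 ppos.
Qed.

(** The factor is the inverse of the probability of generating the orbit from position [p]. It does
    not depend on [j], so it drops out of all ratios of weights. *)
Lemma weightE j : (j <= size U)%N ->
  weight t (- p%:Z + j%:Z) = gibbs (opos x U p) / oweight x U p * oweight x U j.
Proof.
move=> jU; have [pj|jp] := leqP p j.
  have -> : - p%:Z + j%:Z = (j - p)%N%:Z by lia.
  by rewrite /Defs.weight /= weight_forwardE ?subnKC.
have -> : - p%:Z + j%:Z = Negz (p - j).-1 by rewrite NegzE; lia.
by rewrite /Defs.weight weight_backwardE; [congr (_ * oweight _ _ _); lia|lia].
Qed.

End weights.

(** * Expected output of the doubling loop *)

Section transition.
Variable w : 'cV[R]_d -> R.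
Hypothesis w_ge0 : forall x, 0 <= w x.
Local Notation F := (fun x : 'cV[R]_d => (w x)%:E).
Local Notation g := (fun z : phase => w z.1).

Lemma weight_ge0 t j : 0 <= weight t j.
Proof.
have pp t' j' : 0 <= p_plus mu M h delta p_micro t' j' by exact: p_fwd_ge0.
have pm t' j' : 0 <= p_minus mu M h delta p_micro t' j' by exact: p_bwd_ge0.
have bz t' j' : 0 <= boltzmann mu M t' j' by exact: expR_ge0.
have wf n : 0 <= weight_forward mu M h delta p_micro t n.
  elim: n => [|n IH] /=; first exact: bz.
  by apply: mulr_ge0 => //; apply: mulr_ge0; exact: divr_ge0.
have wb n : 0 <= weight_backward mu M h delta p_micro t n.
  elim: n => [|n IH] /=; first exact: bz.
  by apply: mulr_ge0 => //; apply: mulr_ge0; exact: divr_ge0.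
by case: j => n; [exact: wf|exact: wb].
Qed.

Lemma orbit_weight_ge0 t a n : 0 <= orbit_weight mu M h delta p_micro t a n.
Proof. by apply: sumr_ge0 => m _; exact: weight_ge0. Qed.

(** The continuation of [doubling] once the extension is generated, with acceptance and index draw
    written out as sums, to be matched with [step_law]. *)
Definition after_extension k (b1 : bool) B (t : traj) (a b i : int) : \bar R :=
  let a_ext := if b1 then b + 1 else a - (2 ^ k)%:Z in
  let b_ext := if b1 then b + (2 ^ k)%:Z else a - 1 in
  let a' := if b1 then a else a_ext in
  let b' := if b1 then b_ext else b in
  let q := Num.min 1 (orbit_weight mu M h delta p_micro t a_ext (2 ^ k) /
                      orbit_weight mu M h delta p_micro t a (2 ^ k)) in
  let G i' := if u_turn M t a' b' then F (tpos t i').1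
              else doubling k.+1 B t a' b' i' F in
  (if sub_u_turn M t a_ext k then F (tpos t i).1
   else q%:E * (\sum_(m < 2 ^ k)
      (weight t (a_ext + m%:Z) / \sum_(m' < 2 ^ k) weight t (a_ext + m'%:Z))%:E
      * G (a_ext + m%:Z)%R) + (1 - q)%:E * G i)%E.

Lemma doubling_cons k b1 B t a b i :
  doubling k (b1 :: B) t a b i F
  = (if b1 then extend_forward (2 ^ k) t b else extend_backward (2 ^ k) t a)
      (fun t' => after_extension k b1 B t' a b i).
Proof.
rewrite /= /bind; congr (_ _); apply/funext => t'.
rewrite /after_extension; case: ifP => // _.
rewrite /bernoulli_law /proportional_law /ret.
by congr (_ * _ + _ * _)%E; [apply: eq_bigr => m _; congr (_ * _)%E|]; case: ifP.
Qed.

Lemma after_extension_ge0 k b1 B t a b i :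
  (forall t' a' b' i', 0 <= doubling k.+1 B t' a' b' i' F)%E ->
  (0 <= after_extension k b1 B t a b i)%E.
Proof.
move=> D0.
have G0 t' a' b' i' : (0 <= if u_turn M t' a' b' then F (tpos t' i').1
    else doubling k.+1 B t' a' b' i' F)%E.
  by case: ifP => _; rewrite ?lee_fin.
rewrite /after_extension; case: ifP => _; first by rewrite lee_fin.
rewrite adde_ge0// mule_ge0// ?lee_fin ?le_min ?ler01 ?divr_ge0 ?orbit_weight_ge0//.
  apply: sume_ge0 => m _; rewrite mule_ge0// lee_fin divr_ge0 ?weight_ge0//.
  by apply: sumr_ge0 => m' _; exact: weight_ge0.
by rewrite subr_ge0 ge_min lexx.
Qed.

Lemma doubling_ge0 k B t a b i : (0 <= doubling k B t a b i F)%E.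
Proof.
elim: B k t a b i => [|b1 B IH] k t a b i; first by rewrite /= /ret lee_fin.
have A0 t' : (0 <= after_extension k b1 B t' a b i)%E by exact: after_extension_ge0.
rewrite doubling_cons; case: b1 A0 => A0.
  rewrite extend_forwardE//; apply: level_sum_ge0 => E.
  by rewrite mule_ge0// lee_fin pr_fwd_ge0// => *; exact: p_fwd_ge0.
rewrite extend_backwardE//; apply: level_sum_ge0 => E.
by rewrite mule_ge0// lee_fin pr_bwd_ge0// => *; exact: p_bwd_ge0.
Qed.

Section after_extension_lemmas.
Variables (k : nat) (t : traj) (x : phase) (U : seq nat) (p : nat).
Hypotheses (tU : represents t (- p%:Z) x U) (pU : (p <= size U)%N).
Hypotheses (sU : size U = (2 ^ k.+1).-1) (Vp : oweight x U p != 0).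

Lemma size_unionE j : (j <= size U)%N = (j < 2 ^ k.+1)%N.
Proof. by rewrite sU -ltnS prednK ?expn_gt0. Qed.

Lemma u_turnE i j : (i < 2 ^ k.+1)%N -> (j < 2 ^ k.+1)%N ->
  u_turn M t (- p%:Z + i%:Z) (- p%:Z + j%:Z) = uturn (opos x U i) (opos x U j).
Proof. by move=> iU jU; rewrite /u_turn !tU.1 ?size_unionE. Qed.

Lemma sub_u_turnE o : (o + 2 ^ k <= 2 ^ k.+1)%N ->
  sub_u_turn M t (- p%:Z + o%:Z) k = subturn x U o k.
Proof.
move=> oU; rewrite /sub_u_turn /subturn.
apply: eq_existsb => r; apply: eq_existsb => m.
have rk : (r <= k)%N by rewrite -ltnS.
have E : (2 ^ k = 2 ^ r * 2 ^ (k - r))%N by rewrite -expnD subnKC.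
have le : (m.+1 * 2 ^ (k - r) <= 2 ^ k)%N by rewrite E leq_mul2r ltn_ord orbT.
have lt := expn_gt0 2 (k - r); rewrite mulSn in le *.
rewrite -u_turnE; [|lia|lia].
by congr u_turn; lia.
Qed.

Lemma orbit_weightE o : (o + 2 ^ k <= 2 ^ k.+1)%N ->
  orbit_weight mu M h delta p_micro t (- p%:Z + o%:Z) (2 ^ k)
  = gibbs (opos x U p) / oweight x U p * bweight x U o k.
Proof.
move=> oU; rewrite /orbit_weight /bweight mulr_sumr; apply: eq_bigr => m _.
have := ltn_ord m => mk.
rewrite -(weightE tU pU Vp); last by rewrite size_unionE; lia.
by congr weight; lia.
Qed.

Lemma after_extensionE b1 B a b i q :
  (forall q', (q' < 2 ^ k.+1)%N ->
    doubling k.+1 B t (- p%:Z) (- p%:Z + (size U)%:Z) (- p%:Z + q'%:Z) F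
    = outlaw g B k.+1 x U q') ->
  a = - p%:Z + (off b1 k)%:Z -> b = a + (2 ^ k).-1%:Z -> i = a + q%:Z ->
  (q < 2 ^ k)%N ->
  after_extension k b1 B t a b i
  = step_law g b1 k x U q (fun q' => if whole_turn k.+1 x U
      then (g (opos x U q'))%:E else outlaw g B k.+1 x U q').
Proof.
move=> IH aE bE iE qk; have k0 := expn_gt0 2 k.
have oU c : (off c k + 2 ^ k <= 2 ^ k.+1)%N by rewrite expnS; case: c => /=; lia.
have kS : (2 ^ k.+1 = 2 ^ k + 2 ^ k)%N by rewrite expnS; lia.
rewrite /after_extension.
have -> : (if b1 then b + 1 else a - (2 ^ k)%:Z) = - p%:Z + (off (~~ b1) k)%:Z.
  by rewrite bE aE; case: (b1) => /=; lia.
have -> : (if b1 then a else - p%:Z + (off (~~ b1) k)%:Z) = - p%:Z.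
  by rewrite aE; case: (b1) => /=; lia.
have -> : (if b1 then if b1 then b + (2 ^ k)%:Z else a - 1 else b) = - p%:Z + (size U)%:Z.
  by rewrite bE aE sU kS; case: (b1) => /=; lia.
have -> : i = - p%:Z + (off b1 k + q)%N%:Z by rewrite iE aE; lia.
rewrite aE !sub_u_turnE// !orbit_weightE//.
(* The common factor of all weights; being nonzero, it cancels in the acceptance ratio and in the
   index probabilities. *)
have c0 : gibbs (opos x U p) / oweight x U p != 0.
  by rewrite mulf_neq0 ?invr_eq0// gt_eqF ?gibbs_gt0.
rewrite -[u_turn _ _ _ _]/(u_turn M t (- p%:Z) (- p%:Z + (size U)%:Z)).
have -> : u_turn M t (- p%:Z) (- p%:Z + (size U)%:Z) = whole_turn k.+1 x U.
  rewrite -[X in u_turn _ _ X]addr0 (u_turnE (i := 0)) ?expn_gt0//; last first.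
    by rewrite -size_unionE.
  by rewrite /whole_turn sU.
have GE q' : (q' < 2 ^ k.+1)%N ->
    (if whole_turn k.+1 x U then F (tpos t (- p%:Z + q'%:Z)).1
     else doubling k.+1 B t (- p%:Z) (- p%:Z + (size U)%:Z) (- p%:Z + q'%:Z) F)
    = (if whole_turn k.+1 x U then (g (opos x U q'))%:E else outlaw g B k.+1 x U q').
  by move=> q'k; rewrite IH// tU.1 ?size_unionE.
rewrite /step_law.
have olt c m : (m < 2 ^ k)%N -> (off c k + m < 2 ^ k.+1)%N.
  by move=> mk; have := oU c; lia.
case: ifP => _; first by rewrite tU.1 ?size_unionE ?olt.
rewrite GE ?olt// -mulf_div divff// mul1r -/(accept b1 k x U).
congr (_ * _ + _)%E; apply: eq_bigr => m _.
rewrite -[- p%:Z + _ + _]addrA -PoszD GE ?olt//; congr (_%:E * _)%E.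
rewrite (weightE tU pU Vp) ?size_unionE ?olt//.
have -> : \sum_(m' < 2 ^ k) weight t (- p%:Z + (off (~~ b1) k)%:Z + m'%:Z)
    = gibbs (opos x U p) / oweight x U p * bweight x U (off (~~ b1) k) k.
  by rewrite -orbit_weightE.
by rewrite -mulf_div divff// mul1r.
Qed.

End after_extension_lemmas.

(** The right side does not mention the start [p]: the weights depend on it only through a common
    factor, and the U-turn tests only see the orbit. *)
Lemma doublingE B k t x U p q : represents t (- p%:Z) x U ->
  size U = (2 ^ k).-1 -> (p <= size U)%N -> oweight x U p != 0 -> (q < 2 ^ k)%N ->
  doubling k B t (- p%:Z) (- p%:Z + (size U)%:Z) (- p%:Z + q%:Z) F
  = outlaw g B k x U q.
Proof.
elim: B k t x U p q => [|b1 B IH] k t x U p q tU sU pU Vp qk.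
  by rewrite /= /ret tU.1// sU; have := expn_gt0 2 k; lia.
rewrite doubling_cons; have k0 := expn_gt0 2 k.
case: b1 => /=.
  rewrite extend_forwardE => [|t']; last exact/after_extension_ge0/doubling_ge0.
  apply: eq_level_sum => E sE.
  have sUE : size (U ++ E) = (2 ^ k.+1).-1 by rewrite size_cat sU sE pow2_predD.
  have prE : pr_fwd (tpos t (- p%:Z + (size U)%:Z)) E 0 (size E)
      = pr_fwd x (U ++ E) (2 ^ k).-1 (2 ^ k.+1).-1.
    rewrite tU.1// -(opos_catl macro x E (leqnn _)) -pr_fwd_catr addn0.
    by rewrite -sU -sUE size_cat.
  (* On an extension of probability 0 the algorithm's weights may be degenerate, but both sides
     carry the factor 0. Otherwise the weight at [p] stays nonzero on the joined orbit and the
     induction goes on. *)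
  rewrite prE; have [->|pr0] := eqVneq (pr_fwd x (U ++ E) (2 ^ k).-1 (2 ^ k.+1).-1) 0.
    by rewrite !mul0e.
  have tUE := represents_forward_traj E tU.
  have VpE : oweight x (U ++ E) p != 0.
    rewrite oweight_catl// mulf_neq0//.
    by move: pr0; rewrite -sUE size_cat sU.
  have pUE : (p <= size (U ++ E))%N by rewrite size_cat (leq_trans pU)// leq_addr.
  congr (_ * _)%E; apply: (after_extensionE tUE pUE sUE VpE (b1 := true)).
  - by move=> q' q'k; exact: IH.
  - by rewrite /= addr0.
  - by rewrite sU.
  - by [].
  - by [].
rewrite extend_backwardE => [|t']; last exact/after_extension_ge0/doubling_ge0.
apply: eq_level_sum => E sE.
have sUE : size (E ++ U) = (2 ^ k.+1).-1 by rewrite size_cat sU sE pow2_predDr.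
have tx : tpos t (- p%:Z) = x by have := tU.1 0%N (leq0n _); rewrite addr0 opos0.
have prE : pr_bwd (rewind (tpos t (- p%:Z)) E) E 0 (size E)
    = pr_bwd (rewind x E) (E ++ U) 0 (2 ^ k).
  by rewrite tx -sE pr_bwd_catl.
rewrite prE; have [->|pr0] := eqVneq (pr_bwd (rewind x E) (E ++ U) 0 (2 ^ k)) 0.
  by rewrite !mul0e.
have := represents_backward_traj E tU.
(* Growing to the left by 2^k states shifts the position of the start from [p] to [2 ^ k + p]. *)
have -> : - p%:Z - (size E)%:Z = - (2 ^ k + p)%N%:Z by rewrite sE; lia.
move=> tUE.
have VpE : oweight (rewind x E) (E ++ U) (2 ^ k + p) != 0.
  have := oweight_catr macro p_fwd p_bwd gibbs (rewind x E) E U p.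
  by rewrite (opos_rewind _ _ _ macro_invK) sE => ->; rewrite mulf_neq0.
have pUE : (2 ^ k + p <= size (E ++ U))%N by rewrite size_cat sE leq_add2l.
congr (_ * _)%E; apply: (after_extensionE tUE pUE sUE VpE (b1 := false)) => //=.
- by move=> q' q'k; exact: IH.
- by lia.
- by rewrite sU.
Qed.

End transition.

(** * Detailed balance in phase space and its position marginal *)

Let gibbs_ge0 z : 0 <= gibbs z.
Proof. exact/ltW/gibbs_gt0. Qed.

Let outlaw0_ge0 (u : phase -> R) B z : (forall z, 0 <= u z) ->
  (0 <= outlaw u B 0 z [::] 0)%E.
Proof.
by move=> u0; apply: outlaw_ge0 => //; [exact: p_fwd_ge0|exact: p_bwd_ge0].
Qed.

Let measurable_outlaw0 (u : phase -> R) B : (forall z, 0 <= u z) ->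
  measurable_fun [set: phase] u ->
  measurable_fun [set: phase] (fun z => outlaw u B 0 z [::] 0).
Proof.
move=> u0 mu'; apply: measurable_outlaw => //.
- exact: measurable_macro.
- exact: measurable_macro_inv.
- exact: p_fwd_ge0.
- exact: p_bwd_ge0.
- exact: measurable_p_fwd.
- exact: measurable_p_bwd.
- exact: measurable_gibbs.
- exact: measurable_uturn.
Qed.

Let measurable_indic_fst (A : set 'cV[R]_d) : measurable A ->
  measurable_fun [set: phase] (fun z => \1_A z.1 : R).
Proof.
by move=> mA; apply: (measurableT_comp _ measurable_fst); exact: measurable_indic.
Qed.

Lemma transition_symmetric n (f g : phase -> R) :
  (forall z, 0 <= f z) -> measurable_fun [set: phase] f ->
  (forall z, 0 <= g z) -> measurable_fun [set: phase] g ->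
  (\int[lebesgue_phase]_z ((f z * gibbs z)%:E *
       coin_sum n (fun B => outlaw g B 0 z [::] 0))
   = \int[lebesgue_phase]_z ((g z * gibbs z)%:E *
       coin_sum n (fun B => outlaw f B 0 z [::] 0)))%E.
Proof.
(* Before any doubling the only pair is (0, 0), with the weight of the single state; a kernel
   constant in [p] and [q] is trivially symmetric. *)
pose Q (U : seq nat) x (p q : nat) := oweight x U 0.
have E (u v : phase -> R) : (forall z, 0 <= u z) -> measurable_fun [set: phase] u ->
    (forall z, 0 <= v z) -> measurable_fun [set: phase] v ->
    (\int[lebesgue_phase]_z ((u z * gibbs z)%:E *
       coin_sum n (fun B => outlaw v B 0 z [::] 0)))%E
    = coin_sum n (joint macro macro_inv p_fwd p_bwd gibbs uturn lebesgue_phase 0 Q u v).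
  move=> u0 mu' v0 mv.
  have ug0 z : 0 <= u z * gibbs z by exact: mulr_ge0.
  transitivity (\int[lebesgue_phase]_z coin_sum n (fun B =>
      (u z * gibbs z)%:E * outlaw v B 0 z [::] 0))%E.
    by apply: eq_integral => z _; rewrite coin_sumZ// => B; exact: outlaw0_ge0.
  rewrite integral_coin_sum => [|B z|B].
  - apply: eq_coin_sum => B; apply: eq_integral => z _.
    rewrite !big_ord1 /Q /oweight /pr_bwd /pr_fwd !big_geq//= !mulr1 opos0.
    by rewrite mulrC.
  - by rewrite mule_ge0 ?lee_fin ?outlaw0_ge0.
  - apply: emeasurable_funM; last exact: measurable_outlaw0.
    by apply/measurable_EFinP; apply: measurable_funM => //; exact: measurable_gibbs.
move=> f0 mf g0 mg'; rewrite !E//; apply: joint_sym => //.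
- exact: macroK.
- exact: macro_invK.
- exact: measurable_macro.
- exact: measurable_macro_inv.
- exact: p_fwd_ge0.
- exact: p_bwd_ge0.
- exact: measurable_p_fwd.
- exact: measurable_p_bwd.
- exact: measurable_gibbs.
- exact: measurable_uturn.
- exact: integral_macro.
- move=> U x p q; apply: oweight_ge0 => //.
  + exact: p_fwd_ge0.
  + exact: p_bwd_ge0.
- move=> U p q; apply: measurable_oweight.
  + exact: measurable_macro.
  + exact: measurable_p_fwd.
  + exact: measurable_p_bwd.
  + exact: measurable_gibbs.
- move=> U x p sU; rewrite expn0 ltnS leqn0 => /eqP ->; rewrite big_ord1 /Q.
  suff -> : subturn x U 0 0 = false by rewrite mul1r.
  apply/existsP => -[r /existsP[m]].
  have r0 : r = 0%N :> nat by case: r {m} => -[].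
  have m0 : m = 0%N :> nat by case: m => m /=; rewrite r0 expn0; lia.
  by rewrite m0 r0 uturnxx.
Qed.

Lemma gibbsE x y : gibbs (x, y) =
  mu x * expR (- ((y^T *m invmx M *m y) ord0 ord0 / 2)).
Proof. by rewrite /gibbs /hamiltonian/= opprD opprK expRD lnK ?posrE. Qed.

(** Multiplying the momentum density by [mu x] gives [gibbs] up to the Gaussian normalization. That
    constant and the coin factor 2^-n are the same on both sides of the balance equation, so they
    are never evaluated. *)
Lemma walnuts_kernelE n x (A : set 'cV[R]_d) : measurable A ->
  (walnuts_kernel mu M h delta p_micro n x A * (mu x)%:E
   = ((Num.sqrt ((2 * pi) ^+ d * \det M))^-1 * 2^-1 ^+ n)%:E *
     \int[lebesgue_vec d]_y ((gibbs (x, y))%:E *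
       coin_sum n (fun B => outlaw (fun z => \1_A z.1) B 0 (x, y) [::] 0)))%E.
Proof.
move=> mA; set C := (Num.sqrt _)^-1; have C0 : 0 <= C by rewrite invr_ge0 sqrtr_ge0.
have h0 : 0 <= (2^-1 : R) ^+ n by rewrite exprn_ge0// invr_ge0.
pose S y := coin_sum n (fun B => outlaw (fun z => \1_A z.1) B 0 (x, y) [::] 0).
rewrite -[RHS]/(_ * \int[lebesgue_vec d]_y ((gibbs (x, y))%:E * S y))%E.
have oA0 B z : (0 <= outlaw (fun z => \1_A z.1) B 0 z [::] 0)%E.
  exact: outlaw0_ge0.
have S0 y : (0 <= S y)%E by apply: coin_sum_ge0 => B; exact: oA0.
have mS : measurable_fun [set: 'cV[R]_d] S.
  apply: measurable_coin_sum => B.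
  apply: (measurable_fun_pair2 (f := fun z => outlaw (fun z => \1_A z.1) B 0 z [::] 0)).
  by apply: measurable_outlaw0 => //; exact: measurable_indic_fst.
rewrite -ge0_integralZl_EFin//; last 3 first.
- by move=> y _; rewrite mule_ge0// lee_fin gibbs_ge0.
- apply: emeasurable_funM => //; apply/measurable_EFinP.
  apply: (measurable_fun_pair2 (f := gibbs)); exact: measurable_gibbs.
- exact: mulr_ge0.
pose q (y : 'cV[R]_d) : R := expR (- ((y^T *m invmx M *m y) ord0 ord0 / 2)).
have -> : walnuts_kernel mu M h delta p_micro n x A
    = (\int[lebesgue_vec d]_y ((C * q y * 2^-1 ^+ n)%:E * S y))%E.
  apply: eq_integral => y _; rewrite /bind /fair_coins.
  rewrite [in RHS]EFinM -[RHS]muleA; congr (_ * _)%E.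
  rewrite /S -sum_tuple_coin ge0_sume_distrr => [|B _]; last exact: oA0.
  apply: eq_bigr => B _; congr (_ * _)%E.
  pose t : traj := Trajectory (fun=> (x, y)) (fun=> 1%N).
  have tU : represents t (- 0%N%:Z) (x, y) [::].
    by split => // j; rewrite leqn0 => /eqP ->; rewrite opos0.
  have V0 : oweight (x, y) [::] 0 != 0.
    by rewrite /oweight /pr_bwd /pr_fwd !big_geq// !mulr1 gt_eqF// gibbs_gt0.
  have A0 z : 0 <= \1_A z :> R by [].
  by rewrite -(@doublingE \1_A A0 B 0 t _ _ _ 0 tU).
rewrite muleC -ge0_integralZl_EFin//; last 3 first.
- by move=> y _; rewrite mule_ge0// lee_fin !mulr_ge0// expR_ge0.
- apply: emeasurable_funM => //; apply/measurable_EFinP.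
  apply: measurable_funM; last exact: measurable_cst.
  apply: measurable_funM; first exact: measurable_cst.
  apply: (measurableT_comp (@measurable_expR R)); apply: measurable_funN.
  apply: measurable_funM; last exact: measurable_cst.
  apply: measurable_mxE; apply: measurable_mulmxf; last exact: measurable_id.
  apply: measurable_mulmxf; last exact: measurable_cst.
  by apply: measurable_trmxf; exact: measurable_id.
- exact/ltW.
apply: eq_integral => y _; rewrite !muleA -!EFinM; congr (_%:E * _)%E.
by rewrite gibbsE -/(q y); ring.
Qed.

Lemma integral_walnuts_kernel n (A A' : set 'cV[R]_d) : measurable A -> measurable A' ->
  (\int[lebesgue_vec d]_(x in A)
      (walnuts_kernel mu M h delta p_micro n x A' * (mu x)%:E)
   = ((Num.sqrt ((2 * pi) ^+ d * \det M))^-1 * 2^-1 ^+ n)%:E *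
     \int[lebesgue_phase]_z ((\1_A z.1 * gibbs z)%:E *
       coin_sum n (fun B => outlaw (fun z => \1_A' z.1) B 0 z [::] 0)))%E.
Proof.
move=> mA mA'; set C := _ * _; have C0 : 0 <= C.
  by rewrite mulr_ge0 ?exprn_ge0 ?invr_ge0 ?sqrtr_ge0.
have oA0 B z : (0 <= outlaw (fun z => \1_A' z.1) B 0 z [::] 0)%E.
  exact: outlaw0_ge0.
pose S z := coin_sum n (fun B => outlaw (fun z => \1_A' z.1) B 0 z [::] 0).
have S0 z : (0 <= S z)%E by apply: coin_sum_ge0 => B; exact: oA0.
have mS : measurable_fun [set: phase] S.
  apply: measurable_coin_sum => B.
  by apply: measurable_outlaw0 => //; exact: measurable_indic_fst.
have f0 z : (0 <= (\1_A z.1 * gibbs z)%:E * S z)%E.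
  by rewrite mule_ge0// lee_fin mulr_ge0// gibbs_ge0.
have mf : measurable_fun [set: phase] (fun z => (\1_A z.1 * gibbs z)%:E * S z)%E.
  apply: emeasurable_funM => //; apply/measurable_EFinP.
  apply: measurable_funM; last exact: measurable_gibbs.
  exact: measurable_indic_fst.
rewrite ge0_integral_lebesgue_phase// -ge0_integralZl_EFin//; last 2 first.
- by move=> x _; exact: integral_ge0.
- exact: (measurable_fun_fubini_tonelli_F (m2 := lebesgue_vec d) _ mf f0).
rewrite [LHS]integral_mkcond; apply: eq_integral => x _.
rewrite /patch; have [xA|xA] := boolP (x \in A).
  rewrite walnuts_kernelE//; congr (_ * _)%E; apply: eq_integral => y _.
  by rewrite indicE xA mul1r.
under eq_integral => y _ do rewrite indicE (negbTE xA) mul0r mul0e.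
by rewrite integral0 mule0.
Qed.

End instance.

Theorem theorem3 (R : realType) (d : nat) (mu : 'cV[R]_d -> R) (M : 'M[R]_d)
    (h delta : R) (m_max : nat) (p_micro : nat -> nat -> R)
    (mu_gt0 : forall x, 0 < mu x)
    (mu_int : (lebesgue_vec d).-integrable setT (EFin \o mu))
    (mu_C1 : continuously_differentiable mu)
    (M_spd : symmetric_posdef M)
    (h_gt0 : 0 < h) (delta_gt0 : 0 < delta)
    (p_micro_pmf : forall n : nat, is_pmf (p_micro (2 ^ n)%N))
    (micro_exists : forall z : 'cV[R]_d * 'cV[R]_d,
      exists n : nat, micro_ok mu M h delta z n)
    (A A' : set 'cV[R]_d) (mA : measurable A) (mA' : measurable A') :
  (\int[lebesgue_vec d]_(theta in A)
      (walnuts_kernel mu M h delta p_micro m_max theta A' * (mu theta)%:E) =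
   \int[lebesgue_vec d]_(theta in A')
      (walnuts_kernel mu M h delta p_micro m_max theta A * (mu theta)%:E))%E.
Proof.
have p0 n l : 0 <= p_micro (2 ^ n)%N l by have [_ + _] := p_micro_pmf n; exact.
have m1 (X : set 'cV[R]_d) : measurable X ->
    measurable_fun [set: 'cV[R]_d * 'cV[R]_d] (fun z => \1_X z.1 : R).
  by move=> mX; apply: (measurableT_comp _ measurable_fst); exact: measurable_indic.
rewrite !integral_walnuts_kernel//; congr (_ * _)%E.
by apply: transition_symmetric => //; exact: m1.
Qed.
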